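(* Let $\rho\in[0,1)$. Suppose the basic assumptions (i)–(vi) listed in the context hold, that the pair $(f_1,h)$ is $L$-smad on $C$ for some $L>0$, and that $\mathcal{S}_{\lambda'}(x,y)\subset C$ for all $x,y\in C$ and all $\lambda'>0$. Suppose moreover that: (a) $\operatorname{dom} h=\mathbb{R}^d$ and $h$ is $\sigma$-strongly convex on $\mathbb{R}^d$ (for some $\sigma>0$); (b) $\nabla h$ and $\nabla f_1$ are Lipschitz continuous on any bounded subset of $\mathbb{R}^d$; (c) $\Psi$ is level-bounded, i.e., for every $r\in\mathbb{R}$ the set $\{x\in\mathbb{R}^d\mid \Psi(x)\le r\}$ is bounded; (d) $f_2$ is continuously differentiable on an open set $\mathcal{N}_0\subset\mathbb{R}^d$ that contains the set $\mathcal{X}$ of all limiting critical points of $(\mathcal{P})$, and $\nabla f_2$ is locally Lipschitz continuous on $\mathcal{N}_0$; (e) $g$ is convex; (f) there exists a bounded $u$ such that $u\in\partial(\nabla h)$ on any bounded subset of $\mathbb{R}^d$; (g) the auxiliary function $H_M(x,y)=\Psi(x)+MD_h(y,x)$, with $M>0$ satisfying $\frac{\rho}{\lambda}\le M\le\frac1\lambda$, is a KL function on $\mathbb{R}^d\times\mathbb{R}^d$. Let $\{x^k\}_{k=0}^\infty$ be a sequence generated by BPDCAe (with parameter $\rho$) with $0<\lambda L<1$. Let $\Omega$ be the set of accumulation points of $\{x^k\}_{k=0}^\infty$ and $\zeta:=\lim_{k\to\infty}\Psi(x^k)$ (this limit exists). Then: (i) $\lim_{k\to\infty}\operatorname{dist}((0,0),\partial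 H_M(x^k,x^{k-1}))=0$; (ii) the set of accumulation points of $\{(x^k,x^{k-1})\}_{k=0}^\infty$ is $\Upsilon:=\{(x,x)\mid x\in\Omega\}$, and $H_M\equiv\zeta$ on $\Upsilon$; (iii) the sequence $\{x^k\}_{k=0}^\infty$ converges to a limiting stationary point of $(\mathcal{P})$; moreover, $\sum_{k=1}^\infty\|x^k-x^{k-1}\|<\infty$.
   Context: $\|\cdot\|$ is the Euclidean norm, $C\subset\mathbb{R}^d$ is a nonempty, convex, open set, $\overline{C}$ its closure. For convex $f$, $\partial_{\mathrm c}f(x)=\{\xi\in\mathbb{R}^d\mid f(y)-f(x)-\langle\xi,y-x\rangle\ge 0\ \forall y\in\mathbb{R}^d\}$. Limiting subdifferential: for proper lower semicontinuous $f$ and $x\in\operatorname{dom} f$, $\partial f(x)$ is the set of $\xi$ for which there exist $x^k\to x$ with $f(x^k)\to f(x)$ and $\xi^k\to\xi$ such that $\liminf_{y\to x^k,\,y\ne x^k}\frac{f(y)-f(x^k)-\langle\xi^k,y-x^k\rangle}{\|y-x^k\|}\ge 0$ for each $k$. Kernel generating distance: $h\in\mathcal{G}(C)$ means $h:\mathbb{R}^d\to(-\infty,+\infty]$ is proper, lower semicontinuous and convex, $\operatorname{dom} h\subset\overline{C}$, $\operatorname{dom}\partial h=C$, and $h$ is $\mathcal{C}^1$ on $\operatorname{int}\operatorname{dom} h=C$. Bregman distance: $D_h(x,y)=h(x)-h(y)-\langle\nabla h(y),x-y\rangle$ for $x\in\operatorname{dom} h$, $y\in C$. $L$-smad: $(f,h)$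 is $L$-smooth adaptable ($L$-smad) on $C$, $L>0$, if $h\in\mathcal{G}(C)$, $f:\mathbb{R}^d\to(-\infty,+\infty]$ is proper and lower semicontinuous with $\operatorname{dom} h\subset\operatorname{dom} f$ and $\mathcal{C}^1$ on $C$, and $Lh-f$ and $Lh+f$ are convex on $C$. Problem $(\mathcal{P})$: minimize $\Psi(x)=f_1(x)-f_2(x)+g(x)$ over $x\in\overline{C}$. Basic assumptions: (i) $h\in\mathcal{G}(C)$ with $\overline{C}=\overline{\operatorname{dom} h}$; (ii) $f_1:\mathbb{R}^d\to(-\infty,+\infty]$ is proper and convex with $\operatorname{dom} h\subset\operatorname{dom}(f_1+g)$, and $\mathcal{C}^1$ on $C$; (iii) $f_2:\mathbb{R}^d\to(-\infty,+\infty]$ is proper and convex; (iv) $g:\mathbb{R}^d\to(-\infty,+\infty]$ is proper and lower semicontinuous with $\operatorname{dom} g\cap C\neq\emptyset$; (v) $v(\mathcal{P}):=\inf\{\Psi(x)\mid x\in\overline{C}\}>-\infty$; (vi) for any $\lambda>0$, $\lambda g+h$ is supercoercive: $\lim_{\|u\|\to\infty}\frac{\lambda g(u)+h(u)}{\|u\|}=\infty$. For $x,y\in C$, $\xi\in\partial_{\mathrm c}f_2(x)$, $\lambda>0$: $\mathcal{S}_\lambda(x,y):=\operatorname{argmin}_{u\in\overline{C}}\{g(u)+\langle\nabla f_1(y)-\xi,u-y\rangle+\frac1\lambda D_h(u,y)\}$. BPDCAe: choose $x^0=x^{-1}\in C$, $\theta_{-1}=\theta_0=1$, $0<\lambda<1/L$,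 and $\rho$. For $k=0,1,2,\dots$: take any $\xi^k\in\partial_{\mathrm c}f_2(x^k)$; compute $\beta_k=\frac{\theta_{k-1}-1}{\theta_k}$ with $\theta_{k+1}=\frac{1+\sqrt{1+4\theta_k^2}}2$, and $y^k=x^k+\beta_k(x^k-x^{k-1})$; if $y^k\notin C$ or $D_h(x^k,y^k)>\rho D_h(x^{k-1},x^k)$ (adaptive restart), set $\beta_k=0$ with $\theta_{k-1}=\theta_k=1$; then compute $y^k=x^k+\beta_k(x^k-x^{k-1})$ and let $x^{k+1}$ be a minimizer over $y\in\overline{C}$ of $g(y)+\langle\nabla f_1(y^k)-\xi^k,y-y^k\rangle+\frac1\lambda D_h(y,y^k)$. One has $\beta_k\in[0,1)$. When $C=\mathbb{R}^d$: $\tilde x$ is a limiting critical point of $(\mathcal{P})$ if $0\in\nabla f_1(\tilde x)-\partial_{\mathrm c}f_2(\tilde x)+\partial g(\tilde x)$ (the set of these is $\mathcal{X}$), and a limiting stationary point if $0\in\partial\Psi(\tilde x)$. $\partial(\nabla h)(x)$ denotes the generalized (Clarke) Jacobian of the mapping $\nabla h$ at $x$, a set of $d\times d$ matrices equal to $\{\nabla^2h(x)\}$ when $h$ is $\mathcal{C}^2$ near $x$; hypothesis (f) says that on any bounded set there are elements of $\partial(\nabla h)(x)$ that are uniformly bounded in $x$. KL property (for functions on $\mathbb{R}^n$): for $\eta>0$, $\Xi_\eta$ is the set of continuous concave $\phi:[0,\eta)\to\mathbb{R}_+$, $\mathcal{C}^1$ on $(0,\eta)$ with positive derivative, $\phi(0)=0$.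 A proper lower semicontinuous $f$ has the KL property at $\hat z\in\operatorname{dom}\partial f$ if there are $\eta\in(0,+\infty]$, a neighborhood $U$ of $\hat z$ and $\phi\in\Xi_\eta$ with $\phi'(f(z)-f(\hat z))\cdot\operatorname{dist}(0,\partial f(z))\ge 1$ for all $z\in U$ with $f(\hat z)<f(z)<f(\hat z)+\eta$. $f$ is a KL function if it has the KL property at each point of $\operatorname{dom}\partial f$. *)

(* Defs.v *)
From HB Require Import structures.
From mathcomp Require Import all_boot all_order all_algebra.
From mathcomp Require Import all_classical all_reals all_analysis.

Set Implicit Arguments.
Unset Strict Implicit.
Unset Printing Implicit Defensive.

Import Order.TTheory GRing.Theory Num.Theory.
Import numFieldNormedType.Exports.

Local Open Scope classical_set_scope.
Local Open Scope ring_scope.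

(* R^n is 'rV[R]_n.  The norm the library puts on 'rV[R]_n is the sup norm; it
   is used only through its topology (open, closure, nbhs, -->, cluster), which
   is the Euclidean one.  Everything metric goes through enorm. *)
Section Euclidean.
Context {R : realType} {n : nat}.
Implicit Types (u v x y : 'rV[R]_n) (A : set 'rV[R]_n).

Definition dotp u v : R := \sum_i u 0 i * v 0 i.

Definition enorm u : R := Num.sqrt (dotp u u).

Definition ebounded A := exists K : R, forall x, A x -> enorm x <= K.

(* distance of the origin to A; +oo when A is empty *)
Definition dist0 A : \bar R := ereal_inf [set (enorm v)%:E | v in A].

Definition elipschitz_on A (F : 'rV[R]_n -> 'rV[R]_n) :=
  exists K : R, forall x y, A x -> A y ->
    enorm (F x - F y) <= K * enorm (x - y).

End Euclidean.

Section ExtendedFunctions.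
Context {R : realType} {n : nat}.
Implicit Types (f : 'rV[R]_n -> \bar R) (x xi : 'rV[R]_n) (A : set 'rV[R]_n).

Local Open Scope ereal_scope.

Definition edom f := [set x | f x < +oo].

Definition proper_fun f := (forall x, -oo < f x) /\ edom f !=set0.

Definition econvex_on A f := forall x y (t : R), A x -> A y -> (0 < t < 1)%R ->
  f (t *: x + (1 - t) *: y)%R <= t%:E * f x + (1 - t)%:E * f y.

Definition strongly_convex (sigma : R) f :=
  econvex_on setT (fun x => f x - (sigma / 2 * enorm x ^+ 2)%:E).

(* meaningful only at interior points of the set where f is finite *)
Definition grad f x : 'rV[R]_n := \row_i ('D_(delta_mx 0 i) (fine \o f) x)%R.

Definition C1_on A f :=
  [/\ forall x, A x -> f x \is a fin_num,
      forall x, A x -> differentiable (fine \o f) x &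
      {within A, continuous (grad f)}].

Definition csubdiff f x : set 'rV[R]_n :=
  [set xi | forall y, 0 <= f y - f x - (dotp xi (y - x))%:E].

Definition fsubdiff f x : set 'rV[R]_n :=
  [set xi | 0 <= limf_einf
     (fun y => (f y - f x - (dotp xi (y - x))%:E) * ((enorm (y - x))^-1)%:E)
     x^'].

Definition subdiff f x : set 'rV[R]_n :=
  [set xi | edom f x /\
     exists (xs xis : nat -> 'rV[R]_n),
       [/\ xs @ \oo --> x, f \o xs @ \oo --> f x, xis @ \oo --> xi &
           forall k, fsubdiff f (xs k) (xis k)]].

Definition level_bounded f := forall r : R, ebounded [set x | f x <= r%:E].

Definition supercoercive f := forall A : R, exists K : R, forall u,
  (K < enorm u)%R -> A%:E <= f u * ((enorm u)^-1)%:E.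

Definition argmin A f := [set u | A u /\ forall v, A v -> f u <= f v].

End ExtendedFunctions.

Section KL.
Context {R : realType}.

Definition below (eta : \bar R) : set R := [set t | 0 < t /\ (t%:E < eta)%E].

(* desingularizing functions on [0, eta); the values of phi elsewhere are
   irrelevant *)
Definition KL_desing (eta : \bar R) (phi : R -> R) :=
  let dom := [set t : R | 0 <= t /\ (t%:E < eta)%E] in
  [/\ {within dom, continuous phi},
      (forall t, dom t -> 0 <= phi t),
      phi 0 = 0,
      (forall s t a : R, dom s -> dom t -> 0 < a < 1 ->
         a * phi s + (1 - a) * phi t <= phi (a * s + (1 - a) * t)) &
      (forall t : R, below eta t ->
         [/\ derivable phi t 1, 0 < derive1 phi t & {for t, continuous (derive1 phi)}])].

Definition KL_at n (f : 'rV[R]_n -> \bar R) (zh : 'rV[R]_n) :=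
  exists (eta : \bar R) (U : set 'rV[R]_n) (phi : R -> R),
    [/\ (0 < eta)%E, nbhs zh U, KL_desing eta phi &
        forall z, U z -> (f zh < f z)%E -> (f z < f zh + eta)%E ->
          (1 <= (derive1 phi (fine (f z - f zh)))%:E * dist0 (subdiff f z))%E].

Definition KL_function n (f : 'rV[R]_n -> \bar R) :=
  forall z, subdiff f z !=set0 -> KL_at f z.

End KL.

Section Clarke.
Context {R : realType} {n : nat}.

(* Clarke's generalized Jacobian: the convex hull of the limits of Jacobians at
   nearby points of differentiability.  The library's 'J acts on row vectors,
   hence the transpose. *)
Definition clarke_jacobian (F : 'rV[R]_n -> 'rV[R]_n) (x : 'rV[R]_n) :
    set 'M[R]_n :=
  smallest (@convex_set R 'M[R]_n)
    [set A | exists xs : nat -> 'rV[R]_n,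
       [/\ xs @ \oo --> x, forall k, differentiable F (xs k) &
           (fun k => ('J F (xs k))^T) @ \oo --> A]].

End Clarke.

Section Bregman.
Context {R : realType} {d : nat}.
Implicit Types (C : set 'rV[R]_d) (f g h : 'rV[R]_d -> \bar R).

Local Open Scope ereal_scope.

Definition kernel_gen C h :=
  [/\ [/\ proper_fun h, lower_semicontinuous h & econvex_on setT h],
      edom h `<=` closure C,
      [set x | subdiff h x !=set0] = C,
      interior (edom h) = C &
      C1_on C h].

Definition bregman h (x y : 'rV[R]_d) : \bar R :=
  h x - h y - (dotp (grad h y) (x - y))%:E.

Definition Lsmad (L : R) C f h :=
  [/\ (0 < L)%R, kernel_gen C h,
      [/\ proper_fun f, lower_semicontinuous f, edom h `<=` edom f & C1_on C f],
      econvex_on C (fun x => L%:E * h x - f x) &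
      econvex_on C (fun x => L%:E * h x + f x)].

(* The convention (+oo) - (+oo) = -oo is harmless when h is finite everywhere:
   basic_assumptions then forces f1, g and, by ba_inf, f2 to be finite. *)
Definition DCobj f1 f2 g (x : 'rV[R]_d) : \bar R := f1 x - f2 x + g x.

Record basic_assumptions C h f1 f2 g : Prop := BasicAssumptions {
  ba_h : kernel_gen C h /\ closure C = closure (edom h) ;
  ba_f1 : [/\ proper_fun f1, econvex_on setT f1,
              edom h `<=` edom (fun x => f1 x + g x) & C1_on C f1] ;
  ba_f2 : proper_fun f2 /\ econvex_on setT f2 ;
  ba_g : [/\ proper_fun g, lower_semicontinuous g & edom g `&` C !=set0] ;
  ba_inf : -oo < ereal_inf [set DCobj f1 f2 g x | x in closure C] ;
  ba_coercive : forall lambda : R, (0 < lambda)%R ->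
    supercoercive (fun u => lambda%:E * g u + h u) }.

Definition model h f1 g (lambda : R) (xi y u : 'rV[R]_d) : \bar R :=
  g u + (dotp (grad f1 y - xi) (u - y))%:E + (lambda^-1)%:E * bregman h u y.

Definition bregman_argmin C h f1 g (lambda : R) (xi y : 'rV[R]_d) :=
  argmin (closure C) (model h f1 g lambda xi y).

Definition limiting_critical f1 f2 g : set 'rV[R]_d :=
  [set x | exists xi zeta, [/\ csubdiff f2 x xi, subdiff g x zeta &
                               (0 = grad f1 x - xi + zeta)%R]].

Definition limiting_stationary f1 f2 g : set 'rV[R]_d :=
  [set x | subdiff (DCobj f1 f2 g) x 0%R].

Definition theta_next (t : R) : R := ((1 + Num.sqrt (1 + 4 * t ^+ 2)) / 2)%R.

(* x^(-1) = x^0 is encoded by 0.-1 = 0.  tp k and t k are the values of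
   theta_(k-1) and theta_k when iteration k starts; a restart at iteration k
   overwrites both by 1, and theta_(k+1) is obtained from the overwritten
   theta_k. *)
Definition BPDCAe C h f1 f2 g (lambda rho : R) (x : nat -> 'rV[R]_d) : Prop :=
  C (x 0%N) /\
  exists (xi y : nat -> 'rV[R]_d) (tp t beta : nat -> R),
    [/\ tp 0%N = 1%R, t 0%N = 1%R &
    forall k : nat,
      let beta' := ((tp k - 1) / t k)%R in
      let y' := (x k + beta' *: (x k - x k.-1))%R in
      let restart :=
        ~ C y' \/ rho%:E * bregman h (x k.-1) (x k) < bregman h (x k) y' in
      [/\ csubdiff f2 (x k) (xi k),
          restart ->
            [/\ beta k = 0%R, tp k.+1 = 1%R & t k.+1 = theta_next 1],
          ~ restart ->
            [/\ beta k = beta', tp k.+1 = t k & t k.+1 = theta_next (t k)],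
          y k = (x k + beta k *: (x k - x k.-1))%R &
          bregman_argmin C h f1 g lambda (xi k) (y k) (x k.+1)]].

(* a pair (x, y) of R^d x R^d is the row vector row_mx x y of R^(d+d) *)
Definition aux_fun h f1 f2 g (M : R) (z : 'rV[R]_(d + d)) : \bar R :=
  DCobj f1 f2 g (lsubmx z) + M%:E * bregman h (rsubmx z) (lsubmx z).

End Bregman.

(* Main.v *)
Require Import Defs.
From HB Require Import structures.
From mathcomp Require Import all_boot all_order all_algebra.
From mathcomp Require Import all_classical all_reals all_analysis.
From mathcomp Require Import ring lra zify.

(** The range of [M] shapes the descent. One iteration lowers [H_M] by at least [(1/lambda - M)
    D(x^k, x^(k+1)) + (M - rho/lambda) D(x^(k-1), x^k)], with nonnegative weights of sum
    [(1 - rho)/lambda > 0]. At either end of the range one weight vanishes, so it depends on [M]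
    which of two consecutive steps is controlled, and the length argument has to serve both cases.
    Cluster points are first shown to be critical, by bounded subgradients and closed graphs; the
    gradient of [f2] is used only near such points. Accordingly the vanishing of the residual in (i)
    is obtained after convergence and not before it. *)

(* With dom h = R^d every function involved is finite, so g and f2 are
   continuous.  Convexity of L h - f1 and the three-point identity make
   H_M(x^k, x^(k-1)) decrease by a multiple of a squared step.  Subgradients of
   H_M that are small, of the order of two successive steps, come from an
   elementary inequality: near (x, y) the function H_M is minorized by an affine
   function minus a cone of slope about |x - y|, because the gradient of h is
   Lipschitz; minimizing H_M minus the affine function plus a slightly steeper
   smoothed cone produces regular subgradients nearby, and compactness a limiting
   one.  The KL inequality at a single cluster point then bounds the total
   length, since the iterates cannot leave its neighborhood any more; hence the
   whole sequence converges, and the remaining claims are local at its limit. *)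

Set Implicit Arguments.
Unset Strict Implicit.
Unset Printing Implicit Defensive.

Import Order.TTheory GRing.Theory Num.Theory.
Import numFieldNormedType.Exports.

Local Open Scope classical_set_scope.
Local Open Scope ring_scope.

(** * Euclidean structure *)

Section EuclideanAlgebra.
Context {R : realType} {n : nat}.
Implicit Types (u v w : 'rV[R]_n) (a b c : R).

Lemma dotpC u v : dotp u v = dotp v u.
Proof. by apply: eq_bigr => i _; rewrite mulrC. Qed.

Lemma dotpDl u v w : dotp (u + v) w = dotp u w + dotp v w.
Proof. by rewrite -big_split; apply: eq_bigr => i _; rewrite mxE mulrDl. Qed.

Lemma dotpZl a u v : dotp (a *: u) v = a * dotp u v.
Proof. by rewrite /dotp mulr_sumr; apply: eq_bigr => i _; rewrite mxE mulrA. Qed.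

Lemma dotpNl u v : dotp (- u) v = - dotp u v.
Proof. by rewrite -scaleN1r dotpZl mulN1r. Qed.

Lemma dotpBl u v w : dotp (u - v) w = dotp u w - dotp v w.
Proof. by rewrite dotpDl dotpNl. Qed.

Lemma dotpDr u v w : dotp u (v + w) = dotp u v + dotp u w.
Proof. by rewrite dotpC dotpDl !(dotpC _ u). Qed.

Lemma dotpZr a u v : dotp u (a *: v) = a * dotp u v.
Proof. by rewrite dotpC dotpZl dotpC. Qed.

Lemma dotpNr u v : dotp u (- v) = - dotp u v.
Proof. by rewrite dotpC dotpNl dotpC. Qed.

Lemma dotpBr u v w : dotp u (v - w) = dotp u v - dotp u w.
Proof. by rewrite dotpDr dotpNr. Qed.

Definition dotpE := (dotpDl, dotpDr, dotpBl, dotpBr, dotpNl, dotpNr, dotpZl, dotpZr).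

Lemma dotp0l u : dotp 0 u = 0.
Proof. by rewrite -(scale0r u) dotpZl mul0r. Qed.

Lemma dotp0r u : dotp u 0 = 0.
Proof. by rewrite dotpC dotp0l. Qed.

Lemma dotp_ge0 u : 0 <= dotp u u.
Proof. by apply: sumr_ge0 => i _; rewrite -expr2 sqr_ge0. Qed.

Lemma enorm_ge0 u : 0 <= enorm u.
Proof. exact: sqrtr_ge0. Qed.
Hint Resolve enorm_ge0 : core.

Lemma enorm_sqr u : enorm u ^+ 2 = dotp u u.
Proof. by rewrite sqr_sqrtr // dotp_ge0. Qed.

Lemma enorm0 : enorm (0 : 'rV[R]_n) = 0.
Proof. by rewrite /enorm dotp0l sqrtr0. Qed.

Lemma enormZ a u : enorm (a *: u) = `|a| * enorm u.
Proof.
by rewrite /enorm dotpZl dotpZr mulrA -expr2 sqrtrM ?sqr_ge0 // sqrtr_sqr.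
Qed.

Lemma enormN u : enorm (- u) = enorm u.
Proof. by rewrite -scaleN1r enormZ normrN1 mul1r. Qed.

Lemma enormB u v : enorm (u - v) = enorm (v - u).
Proof. by rewrite -enormN opprB. Qed.

Lemma normr_enorm u : `|u| <= enorm u.
Proof.
rewrite -[`|u|]/(mx_norm u) mx_normrE; apply: bigmax_le => [|[i j] _] //=.
rewrite (ord1 i) -ler_sqr ?nnegrE // enorm_sqr.
rewrite /dotp (bigD1 j) //= real_normK ?num_real // expr2 lerDl.
by apply: sumr_ge0 => k _; rewrite -expr2 sqr_ge0.
Qed.

Lemma coord_enorm u i : `|u 0 i| <= enorm u.
Proof.
apply: le_trans (normr_enorm u); rewrite -[`|u|]/(mx_norm u) mx_normrE.
by apply/bigmax_geP; right => /=; exists (0, i).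
Qed.

Lemma enorm_eq0 u : (enorm u == 0) = (u == 0).
Proof.
apply/eqP/eqP => [u0|->]; last exact: enorm0.
by apply/normr0_eq0/le_anti; rewrite normr_ge0 -u0 normr_enorm.
Qed.

Lemma enorm_gt0 u : (0 < enorm u) = (u != 0).
Proof. by rewrite lt_def enorm_ge0 andbT enorm_eq0. Qed.

Lemma cauchy_schwarz u v : dotp u v <= enorm u * enorm v.
Proof.
have [->|u0] := eqVneq u 0; first by rewrite dotp0l enorm0 mul0r.
have [->|v0] := eqVneq v 0; first by rewrite dotp0r enorm0 mulr0.
rewrite -enorm_gt0 in u0; rewrite -enorm_gt0 in v0.
have := dotp_ge0 (enorm v *: u - enorm u *: v).
rewrite !dotpE (dotpC v u) -!enorm_sqr => H.
have {}H : 0 <= (enorm u * enorm v) * (enorm u * enorm v - dotp u v) by nra.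
by rewrite pmulr_rge0 ?mulr_gt0 // subr_ge0 in H.
Qed.

Lemma cauchy_schwarzN u v : - (enorm u * enorm v) <= dotp u v.
Proof. by rewrite lerNl -dotpNl -(enormN u) cauchy_schwarz. Qed.

Lemma enormD u v : enorm (u + v) <= enorm u + enorm v.
Proof.
rewrite -ler_sqr ?nnegrE ?addr_ge0 // enorm_sqr !dotpE (dotpC v u) -!enorm_sqr.
have := cauchy_schwarz u v; lra.
Qed.

Lemma enormDB u v w : enorm (u - w) <= enorm (u - v) + enorm (v - w).
Proof. by rewrite -(subrKA v) enormD. Qed.

Lemma enorm_normr u : enorm u <= n%:R * `|u|.
Proof.
have H : dotp u u <= n%:R * `|u| ^+ 2.
  have -> : n%:R = \sum_(i < n) (1 : R) by rewrite sumr_const card_ord.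
  rewrite mulr_suml.
  apply: ler_sum => i _; rewrite mul1r -expr2 -(real_normK (num_real (u 0 i))).
  rewrite ler_sqr ?nnegrE // -[`|u|]/(mx_norm u) mx_normrE.
  by apply/bigmax_geP; right => /=; exists (0, i).
rewrite -ler_sqr ?nnegrE ?mulr_ge0 // enorm_sqr (le_trans H) // exprMn.
by rewrite ler_wpM2r ?sqr_ge0 // -natrX ler_nat; case: (n) => // k; rewrite leq_pmulr.
Qed.

End EuclideanAlgebra.
#[global] Hint Resolve enorm_ge0 : core.

Section EuclideanTopology.
Context {R : realType} {n : nat}.
Implicit Types (u v p : 'rV[R]_n).

(** The library topology comes from the sup norm, and [normr_enorm] with [enorm_normr] makes the two
    norms equivalent. Dividing by [n%:R + 1] keeps the radius positive also for [n = 0]. *)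
Lemma nbhs_enormP p (A : set 'rV[R]_n) :
  nbhs p A <-> exists2 e, 0 < e & forall q, enorm (q - p) < e -> A q.
Proof.
split=> [/nbhs_normP|] [e /= e0 He]; last first.
  apply: (proj2 (nbhs_normP p A)).
  have n0 : (0 : R) < n%:R + 1 by rewrite natr1 ltr0n.
  exists (e / (n%:R + 1)) => /=; first by rewrite divr_gt0.
  move=> q /=; rewrite distrC ltr_pdivlMr // => qp; apply: He.
  rewrite (le_lt_trans (enorm_normr _)) // (le_lt_trans _ qp) // mulrC.
  by rewrite ler_wpM2l // lerDl.
exists e => // q qp; apply: He => /=; rewrite distrC.
exact: le_lt_trans (normr_enorm _) qp.
Qed.

Lemma cvg_enormP (u : nat -> 'rV[R]_n) p :
  u @ \oo --> p <->
  forall e, 0 < e -> exists N, forall k, (N <= k)%N -> enorm (u k - p) < e.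
Proof.
split=> [up e e0|H A /nbhs_enormP[e e0 He]].
  have /up[N _ HN] : nbhs p [set q | enorm (q - p) < e].
    by apply/nbhs_enormP; exists e.
  by exists N.
by have [N HN] := H e e0; exists N => // k /= /HN /He.
Qed.

Lemma cvg_enorm (u : nat -> 'rV[R]_n) p :
  u @ \oo --> p <-> (fun k => enorm (u k - p)) @ \oo --> (0 : R).
Proof.
rewrite cvg_enormP; split=> [H|/cvgrPdist_lt H e /H[N _ HN]].
  apply/cvgrPdist_lt => e /H[N HN]; exists N => // k /= /HN.
  by rewrite distrC subr0 ger0_norm ?enorm_ge0.
by exists N => k /= /HN /=; rewrite distrC subr0 ger0_norm ?enorm_ge0.
Qed.

Lemma continuous_enormP (F : 'rV[R]_n -> R) :
  continuous F <-> forall p e, 0 < e ->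
    exists2 r, 0 < r & forall q, enorm (q - p) < r -> `|F q - F p| < e.
Proof.
split=> [cF p e e0|H p].
  have /nbhs_enormP[r r0 Hr] : nbhs p [set q | `|F q - F p| < e].
    have /cvgrPdist_lt/(_ e e0) := cF p.
    by apply: filterS => q; rewrite distrC.
  by exists r.
apply: (proj2 (@cvgrPdist_lt _ _ _ (nbhs p) _ F (F p))) => e e0; have [r r0 Hr] := H p e e0.
by apply/nbhs_enormP; exists r => // q /Hr /=; rewrite distrC.
Qed.

Lemma dotp_cvg (u v : nat -> 'rV[R]_n) p q :
  u @ \oo --> p -> v @ \oo --> q -> (fun k => dotp (u k) (v k)) @ \oo --> dotp p q.
Proof.
move=> up vq; apply: cvg_big => [|i _]; first exact: add_continuous.
apply: cvgM.
  exact: (continuous_cvg _ (@coord_continuous R 1 n 0 i p) up).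
exact: (continuous_cvg _ (@coord_continuous R 1 n 0 i q) vq).
Qed.

Lemma enorm_dist_continuous p : continuous (fun q : 'rV[R]_n => enorm (q - p)).
Proof.
apply/continuous_enormP => q e e0; exists e => // z; apply: le_lt_trans.
rewrite ler_norml lerBrDl lerBlDr.
have := enormDB z q p; have := enormDB q z p; rewrite (enormB q z).
lra.
Qed.

Lemma cluster_enormP (u : nat -> 'rV[R]_n) p :
  cluster (u @ \oo) p <->
  forall e N, 0 < e -> exists2 k, (N <= k)%N & enorm (u k - p) < e.
Proof.
split=> [up e N e0|H A B [N _ AN] /nbhs_enormP[e e0 Be]].
  have [_ [[k Nk <-] pk]] : [set u k | k in [set k | (N <= k)%N]] `&`
      [set q | enorm (q - p) < e] !=set0.
    apply: up; first by exists N => // k /= Nk; exists k.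
    by apply/nbhs_enormP; exists e.
  by exists k.
by have [k Nk ke] := H e N e0; exists (u k); split; [exact: AN | exact: Be].
Qed.

Lemma cvg_cluster_set1 (u : nat -> 'rV[R]_n) p :
  u @ \oo --> p -> cluster (u @ \oo) = [set p].
Proof.
move=> /cvg_enormP up; apply/seteqP; split=> [q /cluster_enormP uq|_ ->].
  apply/eqP; rewrite -subr_eq0 -enorm_eq0; apply/eqP/le_anti; rewrite enorm_ge0 andbT.
  apply/ler_addgt0Pr => e e0; rewrite add0r.
  have [N HN] := up (e / 2) (divr_gt0 e0 (ltr0Sn _ 1)).
  have [k /HN kp kq] := uq (e / 2) N (divr_gt0 e0 (ltr0Sn _ 1)).
  have := enormDB q (u k) p; rewrite (enormB q (u k)); lra.
apply/cluster_enormP => e N /up[N1 HN1]; exists (maxn N N1); first exact: leq_maxl.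
by apply: HN1; exact: leq_maxr.
Qed.

(** The index map [e] need not be increasing: [k <= e k] already makes it tend to infinity, which is
    what limits along it use. *)
Lemma cluster_subseq (u : nat -> 'rV[R]_n) p : cluster (u @ \oo) p ->
  exists2 e : nat -> nat, (forall k, (k <= e k)%N) & u \o e @ \oo --> p.
Proof.
move=> /cluster_enormP up.
have /choice[e He] : forall k, exists j, (k <= j)%N /\ enorm (u j - p) < k.+1%:R^-1.
  by move=> k; have [|j kj uj] := up k.+1%:R^-1 k; [rewrite invr_gt0 | exists j].
exists e => [k|]; first by have [] := He k.
apply/cvg_enorm; apply: (squeeze_cvgr _ (cvg_cst 0) cvg_harmonic).
by apply: nearW => k; rewrite enorm_ge0 /= ltW //; have [] := He k.
Qed.

Lemma compact_closed_eball p (r : R) : compact [set q | enorm (q - p) <= r].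
Proof.
apply: bounded_closed_compact.
  exists (r + `|p|); split; first exact: num_real.
  move=> M KM q /= qK; rewrite -(subrK p q) (le_trans (ler_normD _ _)) //.
  rewrite (le_trans _ (ltW KM)) // lerD2r; exact: le_trans (normr_enorm _) qK.
suff : closed ((fun q => enorm (q - p)) @^-1` [set s : R | s <= r]) by [].
apply: preimage_closed; last exact: closed_le.
by move=> q _; apply: enorm_dist_continuous.
Qed.

Lemma enorm_bounded_cluster (u : nat -> 'rV[R]_n) (K : R) :
  (forall k, enorm (u k) <= K) -> exists p, cluster (u @ \oo) p.
Proof.
move=> uK; have [|p [_ up]] := @compact_closed_eball 0 K (u @ \oo) _; last by exists p.
by exists 0%N => // k _ /=; rewrite subr0.
Qed.

Lemma subseq_infty (e : nat -> nat) : (forall k, (k <= e k)%N) -> e @ \oo --> \oo.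
Proof.
by move=> ge A [N _ HN]; exists N => // k /= Nk; apply: HN; apply: leq_trans Nk (ge k).
Qed.

End EuclideanTopology.

(** * Finite convex functions *)

Section ConvexFunctions.
Context {R : realType} {n : nat}.
Implicit Types (F : 'rV[R]_n -> R) (p q u v xi : 'rV[R]_n).

Definition rconvex F := forall p q (t : R), 0 < t < 1 ->
  F (t *: p + (1 - t) *: q) <= t * F p + (1 - t) * F q.

Definition subgrad F p xi := forall q, F p + dotp xi (q - p) <= F q.

Definition has_grad F p v := forall e, 0 < e -> exists2 r, 0 < r &
  forall q, enorm (q - p) < r ->
    `|F q - F p - dotp v (q - p)| <= e * enorm (q - p).

(** The weight [m.+1 / m.+2] splits off the last point and leaves the average of the others:
    Jensen's inequality with equal weights, by induction. *)
Lemma rconvex_avg F m (z : 'I_m -> 'rV[R]_n) : rconvex F -> (0 < m)%N ->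
  F (m%:R^-1 *: \sum_i z i) <= m%:R^-1 * \sum_i F (z i).
Proof.
case: m z => // m z cF _; elim: m z => [|m IH] z; first by rewrite !big_ord1 invr1 scale1r mul1r.
have [t [t01 tE tm]] : exists t : R, [/\ 0 < t < 1, 1 - t = m.+2%:R^-1 &
    t * m.+1%:R^-1 = m.+2%:R^-1].
  exists (m.+1%:R / m.+2%:R); rewrite -[m.+2%:R]natr1.
  have : (0 : R) < m.+1%:R by [].
  move: (m.+1%:R : R) => a a0; split.
  - by rewrite divr_gt0 ?addr_gt0 // ltr_pdivrMr ?addr_gt0 // mul1r ltrDl /=.
  - by field; lra.
  - by field; lra.
rewrite (big_ord_recr m.+1) [in leRHS]big_ord_recr /= scalerDr mulrDr.
have := cF (m.+1%:R^-1 *: \sum_(i < m.+1) z (widen_ord (leqnSn m.+1) i)) (z ord_max) t t01.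
rewrite scalerA tm tE => /le_trans; apply; rewrite lerD2r -tm -mulrA.
by rewrite ler_pM2l ?IH //; case/andP: t01.
Qed.

Lemma rconvex_segment F p u (T t : R) : rconvex F -> `|t| < T ->
  F (p + t *: u) <= `|F (p + T *: u)| + `|F (p - T *: u)|.
Proof.
move=> cF; rewrite ltr_norml => /andP[tl tr].
have T0 : 0 < T by lra.
pose a := (t / T + 1) / 2.
have tT : -1 < t / T < 1 by rewrite ltr_pdivlMr // ltr_pdivrMr // mulN1r mul1r tl.
have a01 : 0 < a < 1 by rewrite /a; lra.
have -> : p + t *: u = a *: (p + T *: u) + (1 - a) *: (p - T *: u).
  apply/rowP => i; rewrite !mxE /a; field; exact: lt0r_neq0.
apply: (le_trans (cF _ _ _ a01)).
have := ler_norm (F (p + T *: u)); have := ler_norm (F (p - T *: u)).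
have := normr_ge0 (F (p + T *: u)); have := normr_ge0 (F (p - T *: u)).
move: a a01 => a; nra.
Qed.

(** A point [q] is the average of the points [p + n (q - p)_i e_i] on the axes through [p]. Each of
    these lies between two endpoints [p + T e_i] and [p - T e_i] that do not depend on [q], so
    finitely many values of [F] bound [F] on the ball. *)
Lemma rconvex_ub F p r : rconvex F ->
  exists2 B, F p <= B & forall q, enorm (q - p) <= r -> F q <= B.
Proof.
move=> cF; pose T := n%:R * `|r| + 1.
pose B := \sum_(i < n) (`|F (p + T *: 'e_i)| + `|F (p - T *: 'e_i)|) + `|F p|.
have B0 : F p <= B.
  apply: (le_trans (ler_norm _)); rewrite lerDr.
  by apply: sumr_ge0 => i _; rewrite addr_ge0.
exists B => // q qr.
have [n0|n0] := posnP n.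
  suff -> : q = p by [].
  by apply/rowP => -[i i0]; exfalso; move: i0; rewrite n0.
have nR : n%:R != 0 :> R by rewrite pnatr_eq0 -lt0n.
pose z i := p + (n%:R * (q - p) 0 i) *: ('e_i : 'rV[R]_n).
have avg : F (n%:R^-1 *: \sum_i z i) <= n%:R^-1 * \sum_i F (z i).
  exact: rconvex_avg.
have qz : q = n%:R^-1 *: \sum_i z i.
  rewrite /z big_split /= sumr_const card_ord -[p *+ n]scaler_nat.
  under eq_bigr do rewrite -scalerA.
  rewrite -scaler_sumr -row_sum_delta -scalerDr scalerA mulVf // scale1r.
  by rewrite addrC subrK.
rewrite qz (le_trans avg) // /B.
have zB i : F (z i) <= `|F (p + T *: 'e_i)| + `|F (p - T *: 'e_i)|.
  apply: rconvex_segment => //; rewrite normrM ger0_norm // /T.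
  rewrite (@le_lt_trans _ _ (n%:R * `|r|)) ?ltrDl // ler_wpM2l //.
  rewrite (le_trans _ (ler_norm r)) // (le_trans _ qr) //.
  exact: coord_enorm.
rewrite (@le_trans _ _ (\sum_(i < n) (`|F (p + T *: 'e_i)| + `|F (p - T *: 'e_i)|))) ?lerDl //.
rewrite ler_pdivrMl ?ltr0n // (le_trans (ler_sum _ (fun i _ => zB i))) //.
rewrite ler_peMl ?ler1n //; apply: sumr_ge0 => i _; exact: addr_ge0.
Qed.

Lemma rconvexW F p q (t : R) : rconvex F -> 0 <= t <= 1 ->
  F (t *: p + (1 - t) *: q) <= t * F p + (1 - t) * F q.
Proof.
move=> cF /andP[]; rewrite le_eqVlt => /predU1P[<- _|t0].
  by rewrite scale0r add0r subr0 scale1r mul0r mul1r add0r.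
rewrite le_eqVlt => /predU1P[->|t1]; last by apply: cF; rewrite t0.
by rewrite subrr scale0r scale1r mul0r mul1r !addr0.
Qed.

(** From above, [q] lies between [p] and the point of the unit sphere around [p] in its direction;
    from below, [p] lies between [q] and the opposite point of that sphere. Both sphere values are
    at most [B], hence the constant [B - F p]. *)
Lemma rconvex_calm F p : rconvex F -> exists2 K, 0 <= K &
  forall q, enorm (q - p) <= 1 -> `|F q - F p| <= K * enorm (q - p).
Proof.
move=> cF; have [B pB HB] := rconvex_ub p 1 cF.
exists (B - F p); first by rewrite subr_ge0.
move=> q; have [->|qp] := eqVneq q p; first by rewrite !subrr enorm0 mulr0 normr0.
have s0 : 0 < enorm (q - p) by rewrite enorm_gt0 subr_eq0.
set s := enorm (q - p) in s0 * => s1.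
have unitB (a : R) : `|a| = s^-1 -> F (p + a *: (q - p)) <= B.
  by move=> aE; apply: HB; rewrite addrAC subrr add0r enormZ aE mulVf ?gt_eqF.
have HBu : F (p + s^-1 *: (q - p)) <= B by rewrite unitB // gtr0_norm ?invr_gt0.
have HBl : F (p + (- s^-1) *: (q - p)) <= B.
  by rewrite unitB // normrN gtr0_norm ?invr_gt0.
have qE : q = s *: (p + s^-1 *: (q - p)) + (1 - s) *: p.
  by apply/rowP => i; rewrite !mxE; field; exact: lt0r_neq0.
have pE : p = (1 + s)^-1 *: q + (1 - (1 + s)^-1) *: (p + (- s^-1) *: (q - p)).
  by apply/rowP => i; rewrite !mxE; field; rewrite !lt0r_neq0 // addr_gt0.
have := @rconvexW F (p + s^-1 *: (q - p)) p s cF; rewrite -qE (ltW s0) s1 => /(_ isT).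
have := @rconvexW F q (p + (- s^-1) *: (q - p)) (1 + s)^-1 cF; rewrite -pE => H2 H1.
have a0 : 0 < (1 + s)^-1 by rewrite invr_gt0 addr_gt0.
have aE : (1 + s)^-1 * (1 + s) = 1 by rewrite mulVf // gt_eqF // addr_gt0.
move: H2 a0 aE; set a := (1 + s)^-1 => H2 a0 aE.
have a1 : a <= 1 by nra.
have {}H2 : F p <= a * F q + (1 - a) * F (p + (- s^-1) *: (q - p)).
  by apply: H2; rewrite ltW.
have {}H2 : F p <= a * F q + (1 - a) * B.
  by rewrite (le_trans H2) // lerD2l ler_wpM2l // subr_ge0.
have asE : 1 - a = a * s by rewrite -aE; ring.
have {H2}H2 : a * ((1 + s) * F p) <= a * (F q + s * B).
  by rewrite mulrA aE mul1r (le_trans H2) // asE le_eqVlt; apply/orP; left; apply/eqP; ring.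
rewrite ler_pM2l // in H2.
rewrite ler_norml; apply/andP; split; nra.
Qed.

Lemma rconvex_continuous F : rconvex F -> continuous F.
Proof.
move=> cF; apply/continuous_enormP => p e e0.
have [K K0 HK] := rconvex_calm p cF.
have K1 : 0 < K + 1 by rewrite ltr_wpDl.
exists (Num.min 1 (e / (K + 1))).
  by rewrite lt_min ltr01 divr_gt0.
move=> q; rewrite lt_min ltr_pdivlMr // => /andP[q1 qe].
rewrite (le_lt_trans (HK _ (ltW q1))) //.
by rewrite (le_lt_trans _ qe) // mulrC ler_wpM2l ?lerDl ?enorm_ge0.
Qed.

(** Testing the subgradient inequality at [q] plus the unit vector along [xi] isolates [enorm xi].
    The test point is within 2 of [p], where [F] is at most [B], and [rconvex_calm] bounds [F q]
    from below. *)
Lemma subgrad_bounded F p : rconvex F -> exists K, forall q xi,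
  enorm (q - p) <= 1 -> subgrad F q xi -> enorm xi <= K.
Proof.
move=> cF; have [B pB HB] := rconvex_ub p 2 cF.
have [K K0 HK] := rconvex_calm p cF.
exists (B - F p + K) => q xi qp sg.
have [->|xi0] := eqVneq xi 0; first by rewrite enorm0 addr_ge0 // subr_ge0.
have s0 : 0 < enorm xi by rewrite enorm_gt0.
have := sg (q + (enorm xi)^-1 *: xi).
rewrite [q + _]addrC addrK dotpZr -enorm_sqr expr2 mulrA mulVf ?gt_eqF // mul1r.
have : F ((enorm xi)^-1 *: xi + q) <= B.
  apply: HB; rewrite -addrA (le_trans (enormD _ _)) //.
  rewrite enormZ ger0_norm ?invr_ge0 ?enorm_ge0 // mulVf ?gt_eqF // -(natr1 1).
  by rewrite lerD2l.
have /ler_normlP[] := HK q qp.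
have := ler_wpM2l K0 qp; lra.
Qed.

(** Convexity on the segment from [p] to [q] reduces the inequality to a point at parameter [t],
    where the linearization error is at most [t * e]; then [t] cancels. *)
Lemma has_grad_subgrad F p v : rconvex F -> has_grad F p v -> subgrad F p v.
Proof.
move=> cF gF q; apply/ler_addgt0Pr => e e0.
have [->|qp] := eqVneq q p; first by rewrite subrr dotp0r addr0 lerDl ltW.
have s0 : 0 < enorm (q - p) by rewrite enorm_gt0 subr_eq0.
have [r r0 Hr] := gF (e / enorm (q - p)) (divr_gt0 e0 s0).
pose t := Num.min 1 (r / 2 / enorm (q - p)).
have t0 : 0 < t by rewrite lt_min ltr01 !divr_gt0.
have t1 : t <= 1 by rewrite ge_min lexx.
have tr : t * enorm (q - p) < r.
  rewrite (@le_lt_trans _ _ (r / 2)) //; last lra.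
  by rewrite -ler_pdivlMr // ge_min lexx orbT.
have := @rconvexW F q p t cF; rewrite (ltW t0) t1 => /(_ isT).
have -> : t *: q + (1 - t) *: p = p + t *: (q - p).
  by apply/rowP => i; rewrite !mxE; ring.
have pE : p + t *: (q - p) - p = t *: (q - p) by rewrite addrAC subrr add0r.
have := Hr (p + t *: (q - p)); rewrite pE enormZ gtr0_norm // => /(_ tr).
rewrite dotpZr mulrCA divfK ?gt_eqF // => /ler_normlP[H _] H2.
have : t * (F p + dotp v (q - p)) <= t * (F q + e) by lra.
by rewrite ler_pM2l.
Qed.

(** A short step from [p] in the direction [xi - v] compares the two linearizations and leaves
    [|xi - v| <= e]. *)
Lemma has_grad_unique F p v xi : has_grad F p v -> subgrad F p xi -> xi = v.
Proof.
move=> gF sg; apply/eqP; rewrite -subr_eq0 -enorm_eq0; apply/eqP/le_anti.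
rewrite enorm_ge0 andbT; apply/ler_addgt0Pr => e e0; rewrite add0r.
have [->|qp] := eqVneq (xi - v) 0; first by rewrite enorm0 ltW.
have s0 : 0 < enorm (xi - v) by rewrite enorm_gt0.
have [r r0 Hr] := gF e e0.
pose t := r / 2 / enorm (xi - v).
have t0 : 0 < t by rewrite !divr_gt0.
have tr : t * enorm (xi - v) < r by rewrite /t divfK ?gt_eqF //; lra.
have := sg (p + t *: (xi - v)).
have := Hr (p + t *: (xi - v)).
rewrite addrAC subrr add0r enormZ gtr0_norm // => /(_ tr) /ler_normlP[_ H] H2.
have : t * enorm (xi - v) * enorm (xi - v) <= t * enorm (xi - v) * e.
  rewrite -mulrA -expr2 enorm_sqr dotpBl mulrBr -!dotpZr; lra.
by rewrite ler_pM2l // mulr_gt0.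
Qed.

Lemma differentiable_has_grad F p : differentiable F p ->
  has_grad F p (\row_i 'D_('e_i) F p).
Proof.
move=> dF e e0; have /eqaddoP/(_ e e0) := diff_locally dF.
move=> /nbhs_enormP[r r0 Hr]; exists r => // q qp.
have := Hr (q - p); rewrite subr0 => /(_ qp).
rewrite /= !fctE /= subrK.
have -> : 'd F p (q - p) = dotp (\row_i 'D_('e_i) F p) (q - p).
  rewrite {1}(row_sum_delta (q - p)) linear_sum; apply: eq_bigr => i _.
  have -> : (\row_i 'D_('e_i) F p) 0 i = 'd F p 'e_i by rewrite mxE; exact: deriveE.
  rewrite mulrC; exact: (linearZZ ('d F p)).
rewrite opprD addrA => /le_trans; apply.
by rewrite ler_wpM2l ?(ltW e0) // normr_enorm.
Qed.
End ConvexFunctions.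

(** * Limiting subgradients *)

Section RealContinuity.
Context {R : realType} {T : topologicalType}.
Implicit Types F G : T -> R.

Lemma realfun_continuousD F G : continuous F -> continuous G -> continuous (fun q => F q + G q).
Proof. by move=> cF cG q; apply: cvgD; [exact: cF | exact: cG]. Qed.

Lemma realfun_continuousB F G : continuous F -> continuous G -> continuous (fun q => F q - G q).
Proof. by move=> cF cG q; apply: cvgB; [exact: cF | exact: cG]. Qed.

Lemma realfun_continuousM F G : continuous F -> continuous G -> continuous (fun q => F q * G q).
Proof. by move=> cF cG q; apply: cvgM; [exact: cF | exact: cG]. Qed.

Lemma realfun_continuous_sqrt F : continuous F -> continuous (fun q => Num.sqrt (F q)).
Proof.
by move=> cF q; apply: (@continuous_comp _ _ _ F Num.sqrt); [exact: cF | exact: sqrt_continuous].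
Qed.

Lemma realfun_continuous_sum (I : finType) (F : I -> T -> R) :
  (forall i, continuous (F i)) -> continuous (fun q => \sum_i F i q).
Proof.
move=> cF q; apply: cvg_big => [|i _]; last exact: cF.
exact: add_continuous.
Qed.

End RealContinuity.

Section LimitingSubgradients.
Context {R : realType} {n : nat}.
Implicit Types (F : 'rV[R]_n -> R) (p q u v xi : 'rV[R]_n).

(** The lower limit in [fsubdiff] in epsilon form for finite functions: multiplying the quotient out
    removes both the division and the exclusion of [q = p]. *)
Definition reg_subgrad F p xi := forall e, 0 < e -> exists2 r, 0 < r &
  forall q, enorm (q - p) < r -> F p + dotp xi (q - p) - e * enorm (q - p) <= F q.

Lemma fsubdiff_fin F p xi : reg_subgrad F p xi -> fsubdiff (EFin \o F) p xi.
Proof.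
move=> H; rewrite /fsubdiff /= limf_einfE; apply/lee_subgt0Pr => e e0.
rewrite sub0e; have [r r0 Hr] := H e e0.
apply: (@le_trans _ _ (ereal_inf [set ((EFin \o F) y - (EFin \o F) p -
    (dotp xi (y - p))%:E)%E * ((enorm (y - p))^-1)%:E
    | y in [set y | y != p /\ (enorm (y - p) < r)%R]]%E)); last first.
  apply: ereal_sup_ubound; exists [set y | y != p /\ (enorm (y - p) < r)%R] => //.
  by apply/nbhs_enormP; exists r => // q qr /=.
apply: le_ereal_inf_tmp => _ [q [qp qr] <-] /=.
rewrite -!EFinB -EFinM lee_fin.
have s0 : 0 < enorm (q - p) by rewrite enorm_gt0 subr_eq0.
by rewrite ler_pdivlMr //; have := Hr q qr; lra.
Qed.

Lemma subdiff_limit F p xi (xs xis : nat -> 'rV[R]_n) : continuous F ->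
  xs @ \oo --> p -> xis @ \oo --> xi -> (forall k, reg_subgrad F (xs k) (xis k)) ->
  subdiff (EFin \o F) p xi.
Proof.
move=> cF xp xixi H; split; first exact: ltry.
exists xs, xis; split => //; last by move=> k; exact: fsubdiff_fin.
apply: cvg_EFin; first exact: nearW.
exact: continuous_cvg (cF p) xp.
Qed.

Lemma reg_subgrad_subdiff F p xi :
  continuous F -> reg_subgrad F p xi -> subdiff (EFin \o F) p xi.
Proof.
move=> cF H; apply: (@subdiff_limit _ _ _ (fun=> p) (fun=> xi)) => //; exact: cvg_cst.
Qed.

Lemma subgrad_reg F p xi : subgrad F p xi -> reg_subgrad F p xi.
Proof.
move=> H e e0; exists 1 => // q _; apply: le_trans (H q).
by rewrite lerBlDr lerDl mulr_ge0 ?enorm_ge0 ?ltW.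
Qed.

(** The function [sqrt (s^2 + |q - p|^2)] is a smooth stand-in for the cone [|q - p|]. With values
    [a] at [z] and [b] at [q], the bound is [2 a b <= a^2 + b^2] divided by [b], followed by
    [b >= s] in the quadratic term. *)
Lemma smooth_norm_upper (s : R) p q z : 0 < s ->
  Num.sqrt (s ^+ 2 + enorm (z - p) ^+ 2) <= Num.sqrt (s ^+ 2 + enorm (q - p) ^+ 2) +
   dotp ((Num.sqrt (s ^+ 2 + enorm (q - p) ^+ 2))^-1 *: (q - p)) (z - q) +
   s^-1 * enorm (z - q) ^+ 2.
Proof.
move=> s0.
have ge_s (y : 'rV[R]_n) : s <= Num.sqrt (s ^+ 2 + enorm y ^+ 2).
  rewrite -[leLHS](gtr0_norm s0) -sqrtr_sqr; apply: ler_wsqrtr.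
  by rewrite lerDl sqr_ge0.
have sqE (y : 'rV[R]_n) : Num.sqrt (s ^+ 2 + enorm y ^+ 2) ^+ 2 = s ^+ 2 + enorm y ^+ 2.
  by rewrite sqr_sqrtr // addr_ge0 // sqr_ge0.
have zE : enorm (z - p) ^+ 2 = enorm (q - p) ^+ 2 + 2 * dotp (q - p) (z - q) + enorm (z - q) ^+ 2.
  have -> : z - p = (q - p) + (z - q) by rewrite [RHS]addrC addrA subrK.
  move: (q - p) (z - q) => u w.
  by rewrite !enorm_sqr !dotpE (dotpC w u); ring.
rewrite dotpZl.
have := ge_s (q - p); have := ge_s (z - p); have := sqE (q - p); have := sqE (z - p).
rewrite zE.
set a := Num.sqrt _; set b := Num.sqrt _.
set D := dotp _ _; set E := enorm (z - q).
move=> aE bE sa sb.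
have b0 : 0 < b by lra.
have : 0 <= E ^+ 2 by rewrite sqr_ge0.
move: (E ^+ 2) aE => E2 aE E20.
have H1 : a <= b + b^-1 * D + b^-1 * E2.
  rewrite -(ler_pM2l b0) !mulrDr !mulrA mulfV ?gt_eqF // !mul1r.
  nra.
apply: (le_trans H1); rewrite lerD2l ler_wpM2r // lef_pV2 //.
Qed.

Lemma dotp_continuous v : continuous (dotp v).
Proof.
apply/continuous_enormP => p e e0.
have K0 : 0 < enorm v + 1 by rewrite ltr_wpDl ?enorm_ge0.
exists (e / (enorm v + 1)) => [|q]; first exact: divr_gt0.
rewrite ltr_pdivlMr // -dotpBr => qe; rewrite ltr_norml.
have := cauchy_schwarz v (q - p); have := cauchy_schwarzN v (q - p).
have := enorm_ge0 (q - p); nra.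
Qed.

(** At a minimizer interior to the ball, [v] minus the gradient of the smoothed cone is a regular
    subgradient of [F]; that gradient has norm at most [kap + e]. *)
Lemma reg_subgrad_near F p v (kap e r d : R) : continuous F -> 0 <= kap -> 0 < e ->
  0 < r -> (forall q, enorm (q - p) < r ->
     F p + dotp v (q - p) - kap * enorm (q - p) <= F q) -> 0 < d -> d < r ->
  exists q xi, [/\ enorm (q - p) <= d, reg_subgrad F q xi & enorm xi <= enorm v + (kap + e)].
Proof.
move=> cF kap0 e0 r0 Fp d0 dr.
have ke0 : 0 < kap + e by rewrite ltr_wpDl.
(* This [s] gives the smoothed cone the height [e * d / 2] at [p]. Comparing [G q] with [G p] then
   yields [|q - p| <= d / 2], so the minimizer is interior. *)
pose s := e * d / 2 / (kap + e).
have s0 : 0 < s by rewrite !divr_gt0 // mulr_gt0.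
have kes : (kap + e) * s = e * d / 2 by rewrite /s mulrC divfK ?gt_eqF.
clearbody s.
pose S q := Num.sqrt (s ^+ 2 + enorm (q - p) ^+ 2).
pose G q := F q - dotp v q + (kap + e) * S q.
have cG : continuous G.
  have cQ : continuous (fun q => s ^+ 2 + enorm (q - p) ^+ 2).
    apply: realfun_continuousD; first exact: cst_continuous.
    apply: realfun_continuousM; exact: enorm_dist_continuous.
  have cS : continuous S.
    exact: realfun_continuous_sqrt cQ.
  apply: realfun_continuousD; first apply: realfun_continuousB.
  - exact: cF.
  - exact: dotp_continuous.
  - apply: realfun_continuousM; [exact: cst_continuous | exact: cS].
have ne : [set q | enorm (q - p) <= d] !=set0.
  by exists p; rewrite /= subrr enorm0 ltW.
have [q] := EVT_min_rV ne (@compact_closed_eball _ _ p d) (continuous_subspaceT cG).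
rewrite inE /= => qd qmin.
have {}qmin z : enorm (z - p) <= d -> G q <= G z by move=> zd; apply: qmin; rewrite inE.
have S_ge y : enorm (y - p) <= S y.
  rewrite -[leLHS](ger0_norm (enorm_ge0 _)) -sqrtr_sqr; apply: ler_wsqrtr.
  by rewrite lerDr sqr_ge0.
have Sq0 : 0 < S q by rewrite sqrtr_gt0 ltr_pwDl ?exprn_gt0 ?sqr_ge0.
have qd2 : enorm (q - p) <= d / 2.
  have := qmin p; rewrite /G /S subrr enorm0 (expr0n _ 2) addr0 sqrtr_sqr (gtr0_norm s0).
  move=> /(_ (ltW d0)); rewrite kes.
  have := Fp q (le_lt_trans qd dr); rewrite dotpBr.
  have := S_ge q; rewrite /S => Sge H1 H2.
  have H3 := ler_wpM2l (ltW ke0) Sge.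
  have : e * enorm (q - p) <= e * (d / 2) by lra.
  by rewrite ler_pM2l.
exists q, (v - (kap + e) *: ((S q)^-1 *: (q - p))); split => //; last first.
  rewrite (le_trans (enormD _ _)) // lerD2l enormN !enormZ gtr0_norm //.
  rewrite -[leRHS]mulr1 ler_pM2l // gtr0_norm ?invr_gt0 //.
  by rewrite ler_pdivrMl // mulr1.
(* The first radius keeps [z] in the ball on which [q] is minimal; the second makes the quadratic
   remainder at most [b * |z - q|]. *)
move=> b b0; exists (Num.min (d / 2) (b * s / (kap + e))).
  by rewrite lt_min divr_gt0 //= divr_gt0 // mulr_gt0.
move=> z; rewrite lt_min => /andP[zq1]; rewrite ltr_pdivlMr // => zq2.
have := qmin z; rewrite /G => /(_ _)/wrap[].
  by rewrite (le_trans (enormDB z q p)) //; lra.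
have := @smooth_norm_upper s p q z s0; rewrite -/(S z) -/(S q).
rewrite dotpBl [dotp ((kap + e) *: _) _]dotpZl !(dotpBr v).
move=> /(ler_wpM2l (ltW ke0)); rewrite !mulrDr.
have : (kap + e) * (s^-1 * enorm (z - q) ^+ 2) <= b * enorm (z - q).
  rewrite mulrCA mulrC ler_pdivrMr // expr2.
  have := ler_wpM2r (enorm_ge0 (z - q)) (ltW zq2); lra.
lra.
Qed.

Lemma approx_subgrad F p v (kap e r : R) : continuous F -> 0 <= kap -> 0 < e -> 0 < r ->
  (forall q, enorm (q - p) < r -> F p + dotp v (q - p) - kap * enorm (q - p) <= F q) ->
  (dist0 (subdiff (EFin \o F) p) <= (enorm v + (kap + e))%:E)%E.
Proof.
move=> cF kap0 e0 r0 Fp.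
(* The factor is at most 1/2, hence each radius is strictly below [r], as [reg_subgrad_near]
   requires. *)
have /choice[q Hq] : forall k, exists q, exists xi, [/\ enorm (q - p) <= r * k.+2%:R^-1,
    reg_subgrad F q xi & enorm xi <= enorm v + (kap + e)].
  move=> k; apply: reg_subgrad_near Fp _ _ => //; first by rewrite mulr_gt0 ?invr_gt0.
  by rewrite gtr_pMr // invf_lt1 // ltr1n.
have /choice[xi {}Hq] := Hq.
have xiv k : enorm (xi k) <= enorm v + (kap + e) by have [] := Hq k.
have [z /cluster_subseq[j jk xij]] := enorm_bounded_cluster xiv.
have zv : enorm z <= enorm v + (kap + e).
  rewrite leNgt; apply/negP => zv.
  have /cvg_enormP/(_ (enorm z - (enorm v + (kap + e))))[|N HN] := xij; first by rewrite subr_gt0.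
  have := HN N (leqnn _); have [_ _] := Hq (j N).
  have := enormDB z (xi (j N)) 0; rewrite !subr0 (enormB z) /=; lra.
have qp : q \o j @ \oo --> p.
  apply: (@cvg_comp _ _ _ j q _ \oo); first exact: subseq_infty.
  apply/cvg_enorm; apply: (@squeeze_cvgr _ _ _ _ (fun=> 0) (fun k => r * k.+1%:R^-1)).
  - apply: nearW => k; rewrite enorm_ge0 /=; have [+ _ _] := Hq k.
    by move=> /le_trans; apply; rewrite ler_pM2l // lef_pV2 ?posrE // ler_nat.
  - exact: cvg_cst.
  - by rewrite -[X in _ --> X](mulr0 r); apply: cvgM; [exact: cvg_cst | exact: cvg_harmonic].
apply: (@le_trans _ _ (enorm z)%:E); last by rewrite lee_fin.
apply: ereal_inf_lbound; exists z => //.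
by apply: (subdiff_limit cF qp xij) => k /=; have [] := Hq (j k).
Qed.

End LimitingSubgradients.

(** * Kurdyka-Lojasiewicz inequality and finite length *)

Section KurdykaLojasiewicz.
Context {R : realType}.

(** For a concave function the chord over [[t, s]] is at least as steep as the derivative at [s].
    The difference quotient is taken at the increment [- (a * (s - t))], which lands on the convex
    combination [a * t + (1 - a) * s]. *)
Lemma KL_desing_gt0 (eta : \bar R) phi (s t : R) : KL_desing eta phi ->
  below eta s -> 0 <= t <= s -> derive1 phi s * (s - t) <= phi s - phi t.
Proof.
move=> [_ _ _ conc der] sb /andP[t0]; rewrite le_eqVlt => /predU1P[->|ts].
  by rewrite !subrr mulr0.
have [s0 se] := sb; have [ds _ _] := der s sb.
have st0 : 0 < s - t by rewrite subr_gt0.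
rewrite -ler_pdivlMr //; apply/ler_addgt0Pr => e e0.
move: ds => /cvg_ex[l /[dup] /cvg_lim phil].
have -> : derive1 phi s = l.
  by rewrite derive1E /derive phil.
move=> /cvgrPdist_lt/(_ e e0); rewrite near_withinE => /nbhs_normP[d /= d0 Hd].
pose a := Num.min (2^-1) (d / 2 / (s - t)).
have a0 : 0 < a by rewrite lt_min invr_gt0 ltr0n /= !divr_gt0.
have a1 : a < 1.
  by rewrite (le_lt_trans (_ : _ <= 2^-1)) ?ge_min ?lexx // invf_lt1 // ltr1n.
have ad : a * (s - t) < d.
  rewrite (@le_lt_trans _ _ (d / 2)) //; last lra.
  by rewrite -ler_pdivlMr // ge_min lexx orbT.
have h0 : a * (s - t) > 0 by rewrite mulr_gt0.
have := Hd (- (a * (s - t))).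
rewrite /= sub0r opprK gtr0_norm // oppr_eq0 gt_eqF // => /(_ ad isT).
have -> : - (a * (s - t)) *: 1 + s = a * t + (1 - a) * s :> R.
  by rewrite /GRing.scale /=; ring.
have := conc t s a (conj t0 (lt_trans (_ : t%:E < s%:E)%E se)) (conj (ltW s0) se).
rewrite a0 a1 lte_fin => /(_ ts isT) H.
move=> /ltr_normlP[_]; rewrite ltrBlDr => /ltW /le_trans; apply; rewrite addrC lerD2r.
rewrite /GRing.scale /= invrN mulNr -mulrN mulrC ler_pdivrMr //.
rewrite mulrCA divfK ?gt_eqF //; lra.
Qed.

Lemma KL_desing_small (eta : \bar R) phi (e : R) : KL_desing eta phi ->
  (0 < eta)%E -> 0 < e -> exists2 d, 0 < d &
  forall t, 0 <= t < d -> (t%:E < eta)%E /\ 0 <= phi t < e.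
Proof.
move=> [/subspace_continuousP cphi phi0 phi00 _ _] eta0 e0.
have [d1 d10 Hd1] : exists2 d, 0 < d & forall t : R, t < d -> (t%:E < eta)%E.
  case: eta eta0 {cphi phi0} => [r r0|_|//]; last by exists 1 => // t _; exact: ltry.
  by exists r.
have /cvgrPdist_lt/(_ e e0) : phi t @[t --> within [set t : R | 0 <= t /\ (t%:E < eta)%E]
    (nbhs (0 : R))] --> (0 : R).
  by rewrite -[X in _ --> X]phi00; exact: cphi (conj (lexx 0) eta0).
rewrite near_withinE => /nbhs_normP[d2 /= d20 Hd2].
exists (Num.min d1 d2) => [|t]; first by rewrite lt_min d10.
rewrite lt_min => /andP[t0 /andP[/Hd1 teta td2]]; split=> //.
have := Hd2 t; rewrite /= sub0r normrN ger0_norm // => /(_ td2 (conj t0 teta)).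
by rewrite sub0r normrN ger0_norm phi0 //.
Qed.

End KurdykaLojasiewicz.

Section FiniteLength.
Context {R : realType} {n : nat}.
Variables (x : nat -> 'rV[R]_n) (xh : 'rV[R]_n) (H : nat -> R) (zeta c C0 : R) (b : bool).
Let a k := enorm (x k - x k.-1).
Hypothesis c_gt0 : 0 < c.
Hypothesis C0_ge0 : 0 <= C0.
(** Read as 0 or 1, [b] tells whether the decrease of [H] at [k] controls the step leading to [x k]
    or the one leading to [x k.+1]. *)
Hypothesis descent : forall k, c * a (k + b)%N ^+ 2 <= H k - H k.+1.
Hypothesis H_cvg : H @ \oo --> zeta.

Let H_decr : nonincreasing_seq H.
Proof.
apply/nonincreasing_seqP => k; rewrite -subr_ge0; apply: le_trans (descent k).
by rewrite mulr_ge0 ?sqr_ge0 // ltW.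
Qed.

Let H_ge k : zeta <= H k.
Proof.
rewrite -(cvg_lim _ H_cvg) //; apply: nonincreasing_cvgn_ge => //.
by apply/cvg_ex; exists zeta.
Qed.

Lemma descent_step_cvg0 : a @ \oo --> (0 : R).
Proof.
have : (fun k => a (k + b)%N) @ \oo --> (0 : R).
  apply/cvgrPdist_lt => e e0.
  have ce0 : 0 < c * e ^+ 2 by rewrite mulr_gt0 // exprn_gt0.
  have /cvgrPdist_lt/(_ _ ce0)[N _ HN] := H_cvg.
  exists N => // k /HN /=; rewrite sub0r normrN (ger0_norm (enorm_ge0 _)).
  rewrite distrC ger0_norm ?subr_ge0 // => Hk.
  rewrite -ltr_sqr ?nnegrE ?enorm_ge0 ?(ltW e0) // -(ltr_pM2l c_gt0).
  apply: le_lt_trans (descent k) _; apply: le_lt_trans Hk.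
  by rewrite lerD2l lerN2.
by rewrite cvg_shiftn.
Qed.

Variables (r0 : R) (K0 : nat) (eta : \bar R) (phi : R -> R).
Hypothesis r0_gt0 : 0 < r0.
Hypothesis eta_gt0 : (0 < eta)%E.
Hypothesis phi_desing : KL_desing eta phi.
Hypothesis KL_ineq : forall k, (K0 <= k)%N ->
  enorm (x k - xh) < r0 -> enorm (x k.-1 - xh) < r0 ->
  zeta < H k -> ((H k - zeta)%:E < eta)%E ->
  1 <= derive1 phi (H k - zeta) * (C0 * (a k + a k.-1)).

Let delta k := phi (H k - zeta).

(** The weight [4^-1] is chosen for summation: it multiplies two steps, so half of the total length
    appears on the right and can be absorbed on the left. *)
Let KL_step k : (K0 <= k)%N -> ((H k - zeta)%:E < eta)%E ->
  enorm (x k - xh) < r0 -> enorm (x k.-1 - xh) < r0 ->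
  a (k + b)%N <= 4^-1 * (a k + a k.-1) + C0 / c * (delta k - delta k.+1).
Proof.
move=> Kk Heta bk bk1; have dk := descent k.
have a0 j : 0 <= a j by exact: enorm_ge0.
(* On the limit level the KL inequality is silent, but there [H] has become constant and descent
   makes the step zero. *)
have [Hk|Hk] := leP (H k) zeta.
  have Hk0 : H k = zeta by apply/le_anti; rewrite Hk H_ge.
  have Hk1 : H k.+1 = zeta.
    by apply/le_anti; rewrite H_ge andbT -Hk0; exact: H_decr.
  rewrite /delta Hk0 Hk1 subrr mulr0 addr0 (@le_trans _ _ 0) //; last first.
    by rewrite mulr_ge0 ?invr_ge0 ?addr_ge0 ?ler0n.
  move: dk; rewrite Hk0 Hk1 subrr pmulr_rle0 // => aa.
  by rewrite -ler_sqr ?nnegrE // expr0n.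
have Hdec : H k.+1 <= H k by exact: H_decr.
have := @KL_desing_gt0 _ eta phi (H k - zeta) (H k.+1 - zeta) phi_desing.
rewrite /below /= subr_gt0 Hk Heta => /(_ (conj isT isT)).
rewrite subr_ge0 H_ge lerD2r Hdec => /(_ isT).
rewrite -/(delta k) -/(delta k.+1) opprB addrA subrK.
have := KL_ineq Kk bk bk1 Hk Heta.
have A0 : 0 <= a k + a k.-1 by rewrite addr_ge0.
move: (derive1 _ _) (a k + a k.-1) (delta k - delta k.+1) A0 => p A D A0 pCA pD.
(* The sign is read off the KL inequality itself: [1 <= p * (C0 * A)] with [C0 * A >= 0]. *)
have pp : 0 <= p by move: pCA; have := mulr_ge0 C0_ge0 A0; nra.
have HD : H k - H k.+1 <= D * (C0 * A).
  have h1 : (H k - H k.+1) * 1 <= (H k - H k.+1) * (p * (C0 * A)).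
    by rewrite ler_wpM2l // subr_ge0.
  have h2 : (p * (H k - H k.+1)) * (C0 * A) <= D * (C0 * A).
    by rewrite ler_wpM2r // mulr_ge0.
  lra.
have {HD}HD : a (k + b)%N ^+ 2 <= C0 / c * D * A.
  rewrite -(ler_pM2l c_gt0) (le_trans dk) // (le_trans HD) // le_eqVlt.
  by apply/orP; left; apply/eqP; field; rewrite gt_eqF.
have D0 : 0 <= D.
  by apply: le_trans pD; rewrite mulr_ge0 // subr_ge0.
have E0 : 0 <= C0 / c * D by rewrite !mulr_ge0 // invr_ge0 ltW.
move: (C0 / c * D) E0 HD => E E0 HD.
(* AM-GM: [A * E <= (A / 4 + E) ^ 2] *)
rewrite -ler_sqr ?nnegrE ?addr_ge0 ?mulr_ge0 ?invr_ge0 ?ler0n //.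
apply: (le_trans HD); have := sqr_ge0 (4^-1 * A - E); nra.
Qed.

(** The ball is never left: [x K] is within [r / 4] of [xh], the length from there stays at most
    [r / 2], and a single step is below [r / 16]. This makes [13 r / 16], and one further step back
    still stays below [r]. *)
Lemma finite_length_tail r : cluster (x @ \oo) xh -> 0 < r <= r0 -> exists K, forall m,
  enorm (x (K + m)%N - xh) < r /\ \sum_(i < m) a (K + i)%N <= r.
Proof.
move=> xh_cluster /andP[r_gt0 rr0].
have a0 j : 0 <= a j by exact: enorm_ge0.
have e0 : 0 < r / 16 by rewrite divr_gt0.
have D1 : 0 < C0 / c + 1 by rewrite ltr_wpDl // divr_ge0 // ltW.
(* Dividing by [C0 / c + 1] makes the telescoped term [C0 / c * delta K] at most [r / 16]; adding 1
   covers [C0 = 0]. *)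
have [d d0 Hd] := KL_desing_small phi_desing eta_gt0 (divr_gt0 e0 D1).
have /cvgrPdist_lt/(_ _ d0)[N1 _ HN1] := H_cvg.
have /cvgrPdist_lt/(_ _ e0)[N2 _ HN2] := descent_step_cvg0.
have Hsmall k : (N1 <= k)%N -> 0 <= H k - zeta < d.
  by move=> /HN1 /=; rewrite distrC ger0_norm subr_ge0 H_ge.
have asmall k : (N2 <= k)%N -> a k < r / 16.
  by move=> /HN2 /=; rewrite sub0r normrN ger0_norm.
(* The successor makes [K] positive and puts [K.-1] beyond [N2] as well, so that the step before [K]
   is small too. *)
have /cluster_enormP/(_ (r / 4) (maxn K0 (maxn N1 N2)).+1)[|K KK xK] := xh_cluster.
  by rewrite divr_gt0.
have [KK0 KN1 KN2 K_gt0] : [/\ (K0 <= K)%N, (N1 <= K)%N, (N2 <= K.-1)%N & (0 < K)%N].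
  by split; lia.
pose T m := \sum_(i < m) a (K + i)%N.
pose S m := \sum_(i < m) a (K + i + b)%N.
pose P m := \sum_(i < m) a (K + i).-1.
have PE m : P m + a (K + m).-1 = a K.-1 + T m.
  elim: m => [|m IH]; first by rewrite /P /T !big_ord0 addn0 addrC.
  by rewrite /P /T !big_ord_recr /= -/(P m) -/(T m) addnS /= IH addrA.
have TS m : T m <= S m + a K.
  rewrite /S; case: (b) => /=; last first.
    by under [in leRHS]eq_bigr do rewrite addn0; rewrite lerDl.
  suff <- : T m + a (K + m)%N = \sum_(i < m) a (K + i + 1)%N + a K by rewrite lerDl.
  elim: m => [|m IH]; first by rewrite /T !big_ord0 addn0.
  by rewrite /T !big_ord_recr /= -/(T m) IH addn1 addnS; ring.
have xT m : enorm (x (K + m)%N - x K) <= T m + a (K + m)%N - a K.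
  elim: m => [|m IH]; first by rewrite addn0 /T big_ord0 subrr enorm0 add0r subrr.
  rewrite (le_trans (enormDB _ (x (K + m)%N) _)) // /T big_ord_recr /= -/(T m).
  have -> : enorm (x (K + m.+1)%N - x (K + m)%N) = a (K + m.+1)%N by rewrite /a addnS.
  lra.
(* Up to single steps [S] and [P] both equal [T], so the assumption reads [T <= T / 2] plus
   multiples of [r / 16]. *)
have Tbound m : S m <= 4^-1 * (T m + P m) + C0 / c * (delta K - delta (K + m)%N) ->
    T m <= r / 2.
  move=> Hm; have := TS m; have := PE m.
  have := asmall K; have := asmall K.-1 KN2; rewrite (leq_trans KN2 (leq_pred K)) => h1 /(_ isT) h2.
  have dK : C0 / c * (delta K - delta (K + m)%N) <= r / 16.
    have [_ /andP[dK0 dK]] := Hd _ (Hsmall K KN1).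
    have [_ /andP[dKm _]] := Hd _ (Hsmall (K + m)%N (leq_trans KN1 (leq_addr _ _))).
    rewrite -/(delta K) in dK dK0; rewrite -/(delta (K + m)%N) in dKm.
    move: dK; rewrite ltr_pdivlMr // => dK.
    have Cc0 : 0 <= C0 / c by rewrite divr_ge0 // ltW.
    have := mulr_ge0 Cc0 dKm; lra.
  have := a0 (K + m).-1; lra.
(* The bound at [m] places [x (K + m)] and its predecessor in the ball, which is what [KL_step]
   needs in order to extend the sum by one term. *)
have key m : S m <= 4^-1 * (T m + P m) + C0 / c * (delta K - delta (K + m)%N).
  elim: m => [|m IH]; first by rewrite /S /T /P !big_ord0 addn0 subrr !(mulr0, addr0).
  have Tm := Tbound m IH.
  have am := asmall (K + m)%N (leq_trans KN2 (leq_trans (leq_pred K) (leq_addr _ _))).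
  have xm : enorm (x (K + m)%N - xh) < r * (13 / 16).
    rewrite (le_lt_trans (enormDB _ (x K) _)) // ; have := xT m; have := a0 K; lra.
  have xm1 : enorm (x (K + m).-1 - xh) < r.
    rewrite (le_lt_trans (enormDB _ (x (K + m)%N) _)) // enormB -/(a (K + m)%N); lra.
  rewrite /S /T /P !big_ord_recr /= -/(S m) -/(T m) -/(P m).
  have Kmle : (K0 <= K + m)%N by rewrite (leq_trans KK0) // leq_addr.
  have [Heta _] := Hd _ (Hsmall (K + m)%N (leq_trans KN1 (leq_addr _ _))).
  have := KL_step Kmle Heta; rewrite addnS => Hstep.
  have : a (K + m + b)%N <= 4^-1 * (a (K + m)%N + a (K + m).-1) +
      C0 / c * (delta (K + m)%N - delta (K + m).+1).
    by apply: Hstep; [apply: lt_le_trans xm _ | apply: lt_le_trans xm1 _] => //; lra.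
  lra.
exists K => m; have Tm := Tbound m (key m); split; last by rewrite (le_trans Tm) //; lra.
rewrite (le_lt_trans (enormDB _ (x K) _)) //; have := xT m; have := a0 K.
have := asmall (K + m)%N (leq_trans KN2 (leq_trans (leq_pred K) (leq_addr _ _))).
lra.
Qed.

(** The tail estimate is used at two radii: arbitrarily small ones give convergence, and [r0] itself
    bounds the length beyond [K]. *)
Lemma finite_length : cluster (x @ \oo) xh ->
  x @ \oo --> xh /\ exists B, forall m, \sum_(1 <= k < m) a k <= B.
Proof.
move=> xh_cluster; split.
  apply/cvg_enormP => e e0.
  have [|K HK] := @finite_length_tail (Num.min e r0) xh_cluster.
    by rewrite lt_min e0 r0_gt0 ge_min lexx orbT.
  exists K => k Kk; rewrite -(subnKC Kk).
  by have [+ _] := HK (k - K)%N; rewrite lt_min => /andP[].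
have [|K HK] := @finite_length_tail r0 xh_cluster; first by rewrite r0_gt0 lexx.
exists (\sum_(i < K) a i + r0) => m.
have a0 j : 0 <= a j by exact: enorm_ge0.
have [_ HKm] := HK m.
apply: (@le_trans _ _ (\sum_(i < K + m) a i)); last first.
  by rewrite big_split_ord /=; apply: lerD.
have [->|m0] := posnP m; first by rewrite big_geq // sumr_ge0.
rewrite -(big_mkord xpredT a) (@big_cat_nat _ _ _ 1 0 (K + m)%N); last 2 first.
- by [].
- by rewrite (leq_trans m0) ?leq_addl.
rewrite (@big_cat_nat _ _ _ m 1 (K + m)%N) //= ?leq_addl //.
by rewrite addrCA lerDl addr_ge0 // sumr_ge0.
Qed.
End FiniteLength.

(** * Bregman distances and the proximal step *)

Section GradientRules.
Context {R : realType} {n : nat}.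
Implicit Types (F G : 'rV[R]_n -> R) (p q v w : 'rV[R]_n).

Lemma has_grad_lin F G p v w (s t : R) : has_grad F p v -> has_grad G p w ->
  has_grad (fun q => s * F q + t * G q) p (s *: v + t *: w).
Proof.
move=> gF gG e e0.
have e1 (u : R) : 0 < e / 2 / (`|u| + 1) by rewrite !divr_gt0 // ltr_wpDl.
have [r1 r10 Hr1] := gF _ (e1 s); have [r2 r20 Hr2] := gG _ (e1 t).
exists (Num.min r1 r2); first by rewrite lt_min r10.
move=> q; rewrite lt_min => /andP[/Hr1 q1 /Hr2 q2].
have bnd (u z : R) : `|z| <= e / 2 / (`|u| + 1) * enorm (q - p) ->
    `|u * z| <= e / 2 * enorm (q - p).
  move=> zb; rewrite normrM.
  apply: (@le_trans _ _ ((`|u| + 1) * (e / 2 / (`|u| + 1) * enorm (q - p)))).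
    by apply: ler_pM => //; rewrite lerDl.
  by rewrite mulrA [(_ + 1) * _]mulrC divfK // gt_eqF // ltr_wpDl.
have -> : s * F q + t * G q - (s * F p + t * G p) - dotp (s *: v + t *: w) (q - p) =
    s * (F q - F p - dotp v (q - p)) + t * (G q - G p - dotp w (q - p)).
  by rewrite dotpDl !dotpZl; ring.
rewrite (le_trans (ler_normD _ _)) //.
have := bnd _ _ q1; have := bnd _ _ q2; lra.
Qed.

Lemma has_grad_sqr p : has_grad (fun q => enorm q ^+ 2) p (2 *: p).
Proof.
move=> e e0; exists e => // q qe.
have -> : enorm q ^+ 2 - enorm p ^+ 2 - dotp (2 *: p) (q - p) = enorm (q - p) ^+ 2.
  by rewrite !enorm_sqr !dotpE (dotpC q p); ring.
by rewrite ger0_norm ?sqr_ge0 // expr2 ler_wpM2r ?enorm_ge0 // ltW.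
Qed.

End GradientRules.

Section Bregman.
Context {R : realType} {n : nat}.
Implicit Types (p q u v w z : 'rV[R]_n).
Variables (h : 'rV[R]_n -> R) (gh : 'rV[R]_n -> 'rV[R]_n).
Hypothesis h_convex : rconvex h.
Hypothesis h_grad : forall p, has_grad h p (gh p).

Definition breg p q := h p - h q - dotp (gh q) (p - q).

Lemma breg_ge0 p q : 0 <= breg p q.
Proof. by have := has_grad_subgrad h_convex (h_grad q) p; rewrite /breg; lra. Qed.

Lemma bregpp p : breg p p = 0.
Proof. by rewrite /breg !subrr dotp0r subrr. Qed.

Lemma breg_le_dotp p q : breg p q <= dotp (gh p - gh q) (p - q).
Proof.
have := has_grad_subgrad h_convex (h_grad p) q.
by rewrite /breg -(opprB p q) dotpNr dotpBl; lra.
Qed.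

Lemma breg_le p q (K : R) : enorm (gh p - gh q) <= K * enorm (p - q) ->
  breg p q <= K * enorm (p - q) ^+ 2.
Proof.
move=> Kpq; apply: (le_trans (breg_le_dotp p q)); apply: (le_trans (cauchy_schwarz _ _)).
by rewrite expr2 mulrA ler_wpM2r ?enorm_ge0.
Qed.

(** This is the first-order inequality at [q] for the convex function [h - sigma / 2 |.|^2], whose
    gradient there is [gh q - sigma *: q]. *)
Lemma breg_strong (sigma : R) p q :
  rconvex (fun z => h z - sigma / 2 * enorm z ^+ 2) ->
  sigma / 2 * enorm (p - q) ^+ 2 <= breg p q.
Proof.
move=> sc.
have gq : has_grad (fun z => h z - sigma / 2 * enorm z ^+ 2) q (gh q - sigma *: q).
  have := has_grad_lin 1 (- (sigma / 2)) (h_grad q) (has_grad_sqr q).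
  rewrite scale1r scalerA mulNr divfK // scaleNr.
  by under eq_fun do rewrite mul1r mulNr.
have := has_grad_subgrad sc gq p.
rewrite /breg !enorm_sqr !dotpE (dotpC q p); lra.
Qed.

Lemma three_points p q u : breg p q - breg u q = breg p u + dotp (gh u - gh q) (p - u).
Proof.
rewrite /breg dotpBl.
have -> : dotp (gh q) (p - q) = dotp (gh q) (p - u) + dotp (gh q) (u - q).
  by rewrite -dotpDr subrKA.
ring.
Qed.

(** Optimality of [u] is tested at [u + t (z - u)]: convexity bounds [g] there, [h] is linearized at
    [u], and dividing by [t] gives the subgradient inequality up to [e]. No sum rule for
    subdifferentials is involved. *)
Lemma prox_subgrad g c (lambda : R) y u : rconvex g -> 0 < lambda ->
  (forall v, g u + dotp c (u - y) + lambda^-1 * breg u y <=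
             g v + dotp c (v - y) + lambda^-1 * breg v y) ->
  subgrad g u (- c - lambda^-1 *: (gh u - gh y)).
Proof.
move=> cg l0 umin z; apply/ler_addgt0Pr => e e0.
have [->|zu] := eqVneq z u; first by rewrite subrr dotp0r addr0 lerDl ltW.
have s0 : 0 < enorm (z - u) by rewrite enorm_gt0 subr_eq0.
(* The accuracy [lambda * e / |z - u|] becomes exactly [t * e] after the step of length
   [t * |z - u|] and the factor [lambda^-1]. *)
have [r r0 Hr] := h_grad u (divr_gt0 (mulr_gt0 l0 e0) s0).
pose t := Num.min 1 (r / 2 / enorm (z - u)).
have t0 : 0 < t by rewrite lt_min ltr01 !divr_gt0.
have t1 : t <= 1 by rewrite ge_min lexx.
have tr : t * enorm (z - u) < r.
  rewrite (@le_lt_trans _ _ (r / 2)) //; last lra.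
  by rewrite -ler_pdivlMr // ge_min lexx orbT.
have := @rconvexW _ _ g z u t cg; rewrite (ltW t0) t1 => /(_ isT).
have -> : t *: z + (1 - t) *: u = u + t *: (z - u).
  by apply/rowP => i; rewrite !mxE; ring.
have pE : u + t *: (z - u) - u = t *: (z - u) by rewrite addrAC subrr add0r.
have := Hr (u + t *: (z - u)); rewrite pE enormZ gtr0_norm // => /(_ tr).
rewrite dotpZr mulrCA divfK ?gt_eqF // => /ler_normlP[_ hh] gg.
have := umin (u + t *: (z - u)).
have := three_points (u + t *: (z - u)) y u; rewrite pE dotpZr.
have -> : breg (u + t *: (z - u)) u = h (u + t *: (z - u)) - h u - t * dotp (gh u) (z - u).
  by rewrite /breg pE dotpZr.
have -> : dotp c (u + t *: (z - u) - y) = dotp c (u - y) + t * dotp c (z - u).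
  by rewrite -dotpZr -dotpDr addrAC.
rewrite !(dotpDl, dotpNl, dotpZl).
have li0 : 0 < lambda^-1 by rewrite invr_gt0.
have lhh := ler_wpM2l (ltW li0) hh.
move: lhh; rewrite mulrCA mulKf ?gt_eqF // => lhh tp um.
rewrite -(ler_pM2l t0); move/(congr1 (fun s : R => lambda^-1 * s)): tp => /=.
clearbody t.
lra.
Qed.

(** Four first-order inequalities are added: for [g] from [u] to [x], for [f2] from [x] to [u], for
    [f1] from [y] to [x], and for [L h - f1] from [y] to [u]. The three-point identity turns the
    gradient terms of [h] into Bregman distances. *)
Lemma prox_step_descent f1 f2 g gf1 (L lambda : R) x y xi u :
  rconvex f1 -> (forall p, has_grad f1 p (gf1 p)) ->
  rconvex (fun z => L * h z - f1 z) -> rconvex g -> 0 < lambda ->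
  subgrad f2 x xi ->
  (forall v, g u + dotp (gf1 y - xi) (u - y) + lambda^-1 * breg u y <=
             g v + dotp (gf1 y - xi) (v - y) + lambda^-1 * breg v y) ->
  f1 u - f2 u + g u + lambda^-1 * breg x u + (lambda^-1 - L) * breg u y <=
  f1 x - f2 x + g x + lambda^-1 * breg x y.
Proof.
move=> cf1 gradf1 cLh cg l0 sf2 umin.
have := prox_subgrad cg l0 umin x.
have := sf2 u.
have := has_grad_subgrad cf1 (gradf1 y) x.
have gy : has_grad (fun z => L * h z - f1 z) y (L *: gh y - gf1 y).
  have := has_grad_lin L (- 1) (h_grad y) (gradf1 y); rewrite scaleN1r.
  by under eq_fun do rewrite mulN1r.
have := has_grad_subgrad cLh gy u.
have := three_points x y u => /(congr1 (fun s : R => lambda^-1 * s)) /=.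
have -> : (lambda^-1 - L) * breg u y =
  lambda^-1 * breg u y - (L * h u - L * h y - L * dotp (gh y) (u - y)).
  by rewrite mulrBl; congr (_ - _); rewrite /breg; ring.
rewrite !(dotpDl, dotpNl, dotpZl).
rewrite -(opprB x u) !dotpNr.
have -> : dotp (gf1 y) (x - y) = dotp (gf1 y) (x - u) + dotp (gf1 y) (u - y).
  by rewrite -dotpDr subrKA.
rewrite ?dotpBl; lra.
Qed.

End Bregman.

(** * Subgradients of the auxiliary function *)

Section PairSpace.
Context {R : realType} {d : nat}.
Implicit Types (u v w z : 'rV[R]_d).

Lemma dotp_row_mx u v w z : dotp (row_mx u v) (row_mx w z) = dotp u w + dotp v z.
Proof.
rewrite /dotp big_split_ord /=; congr (_ + _); apply: eq_bigr => i _.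
  by rewrite !row_mxEl.
by rewrite !row_mxEr.
Qed.

Lemma enorm_row_mx_sqr u v : enorm (row_mx u v) ^+ 2 = enorm u ^+ 2 + enorm v ^+ 2.
Proof. by rewrite !enorm_sqr dotp_row_mx. Qed.

Lemma enorm_row_mx_le u v : enorm (row_mx u v) <= enorm u + enorm v.
Proof.
rewrite -ler_sqr ?nnegrE ?addr_ge0 ?enorm_ge0 // enorm_row_mx_sqr.
have := enorm_ge0 u; have := enorm_ge0 v; nra.
Qed.

Lemma enorm_row_mxl u v : enorm u <= enorm (row_mx u v).
Proof. by rewrite -ler_sqr ?nnegrE ?enorm_ge0 // enorm_row_mx_sqr lerDl sqr_ge0. Qed.

Lemma enorm_row_mxr u v : enorm v <= enorm (row_mx u v).
Proof. by rewrite -ler_sqr ?nnegrE ?enorm_ge0 // enorm_row_mx_sqr lerDr sqr_ge0. Qed.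

Lemma sub_row_mx u v w z : row_mx u v - row_mx w z = row_mx (u - w) (v - z).
Proof. by rewrite opp_row_mx add_row_mx. Qed.

End PairSpace.

Section AuxiliaryFunction.
Context {R : realType} {d : nat}.
Variables (h f1 f2 g : 'rV[R]_d -> R) (gh gf1 : 'rV[R]_d -> 'rV[R]_d) (M : R).
Hypothesis h_convex : rconvex h.
Hypothesis h_grad : forall p, has_grad h p (gh p).
Hypothesis f1_convex : rconvex f1.
Hypothesis f1_grad : forall p, has_grad f1 p (gf1 p).
Hypothesis f2_convex : rconvex f2.
Hypothesis g_convex : rconvex g.
Hypothesis M_ge0 : 0 <= M.
Hypothesis gh_lipschitz : forall p r, exists2 K, 0 <= K & forall q z,
  enorm (q - p) <= r -> enorm (z - p) <= r -> enorm (gh q - gh z) <= K * enorm (q - z).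

Let psi p := f1 p - f2 p + g p.

Definition aux_funr (z : 'rV[R]_(d + d)) :=
  psi (lsubmx z) + M * breg h gh (rsubmx z) (lsubmx z).

(** The linearizations of [f1] and [g] are exact lower bounds; the error [e] comes from [- f2],
    which is concave and is controlled from below through differentiability at [x]. *)
Lemma psi_reg_subgrad x v2 w : has_grad f2 x v2 -> subgrad g x w ->
  reg_subgrad psi x (gf1 x - v2 + w).
Proof.
move=> gf2 sg e e0; have [r r0 Hr] := gf2 e e0; exists r => // q /Hr/ler_normlP[_ H2].
have := has_grad_subgrad f1_convex (f1_grad x) q; have := sg q.
rewrite /psi dotpDl dotpBl; lra.
Qed.

(* Expanding around [x], [D(y', x') - D(y, x)] splits into the gradient term in
   [y'], the quadratic term [- D(x', x)], and a term of slope about [|y - x|]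
   which the Lipschitz continuity of the gradient of h controls without any
   differentiability of that gradient. *)
Lemma breg_lower x y x' y' : breg h gh y x + dotp (gh y - gh x) (y' - y)
   - breg h gh x' x + dotp (gh x - gh x') (y' - x') <= breg h gh y' x'.
Proof.
have := has_grad_subgrad h_convex (h_grad y) y'.
by rewrite /breg !dotpE; lra.
Qed.

Lemma aux_funr_lower x y v2 w K e : has_grad f2 x v2 -> subgrad g x w -> 0 <= K ->
  (forall z, enorm (z - x) <= 1 -> enorm (gh x - gh z) <= K * enorm (x - z)) -> 0 < e ->
  exists2 r, 0 < r & forall q, enorm (q - row_mx x y) < r ->
    aux_funr (row_mx x y)
      + dotp (row_mx (gf1 x - v2 + w) (M *: (gh y - gh x))) (q - row_mx x y)
      - (M * K * enorm (y - x) + e) * enorm (q - row_mx x y) <= aux_funr q.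
Proof.
move=> gf2 sg K0 lipK e0.
have [r1 r10 Hr1] := psi_reg_subgrad gf2 sg (divr_gt0 e0 (ltr0Sn R 1)).
(* The second-order terms sum to [3 M K t^2]: one part from [breg h gh x' x], two from
   [|y' - x'| <= |y - x| + 2 t]. They consume one half of [e], and [psi] the other. *)
have MK0 : 0 < 3 * (M * K) + 1 by rewrite ltr_wpDl // !mulr_ge0.
exists (Num.min (Num.min r1 1) (e / 2 / (3 * (M * K) + 1))).
  by rewrite !lt_min r10 ltr01 !divr_gt0.
move=> q; rewrite -(hsubmxK q); set x' := lsubmx q; set y' := rsubmx q.
rewrite sub_row_mx /aux_funr !row_mxKl !row_mxKr dotp_row_mx.
rewrite 2!lt_min => /andP[/andP[tr1 t1]]; rewrite ltr_pdivlMr // => te.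
have := enorm_row_mxr (x' - x) (y' - y).
have := enorm_row_mxl (x' - x) (y' - y).
move: (enorm (row_mx _ _)) tr1 t1 te => t tr1 t1 te xt yt.
have X0 := enorm_ge0 (x' - x).
have t0 : 0 <= t by apply: le_trans X0 xt.
have := Hr1 x' (le_lt_trans xt tr1).
have lx := lipK x' (le_trans xt (ltW t1)).
have : breg h gh x' x <= K * t ^+ 2.
  apply: (@le_trans _ _ (K * enorm (x' - x) ^+ 2)).
    by apply: (breg_le h_convex h_grad); rewrite enormB (enormB x').
  by rewrite ler_wpM2l // ler_sqr ?nnegrE.
have : - (K * t * (enorm (y - x) + 2 * t)) <= dotp (gh x - gh x') (y' - x').
  apply: le_trans (cauchy_schwarzN _ _); rewrite lerN2.
  apply: ler_pM; rewrite ?enorm_ge0 //.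
    by rewrite (le_trans lx) // ler_wpM2l // enormB.
  have := enormDB y' y x'; have := enormDB y x x'; rewrite (enormB x x'); lra.
have := breg_lower x y x' y'.
rewrite dotpZl => b1 b2 b3 b4.
have {}b1 : breg h gh y x + dotp (gh y - gh x) (y' - y) - K * t ^+ 2 -
    (K * t * (enorm (y - x) + 2 * t)) <= breg h gh y' x' by lra.
have := ler_wpM2l M_ge0 b1.
have : t * (t * (3 * (M * K) + 1)) <= t * (e / 2) by rewrite ler_wpM2l // ltW.
have : 0 <= t ^+ 2 by rewrite sqr_ge0.
have : e / 2 * enorm (x' - x) <= e / 2 * t by rewrite ler_wpM2l // divr_ge0 // ltW.
by lra.
Qed.

Lemma continuous_aux_funr : continuous aux_funr.
Proof.
have cl F : continuous F -> continuous (fun z : 'rV[R]_(d + d) => F (lsubmx z) : R).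
  move=> /continuous_enormP cF; apply/continuous_enormP => p e e0.
  have [r r0 Hr] := cF (lsubmx p) e e0; exists r => // q qr; apply: Hr.
  by rewrite (le_lt_trans _ qr) // -[in leRHS](hsubmxK q) -[in leRHS](hsubmxK p)
    sub_row_mx enorm_row_mxl.
have cr F : continuous F -> continuous (fun z : 'rV[R]_(d + d) => F (rsubmx z) : R).
  move=> /continuous_enormP cF; apply/continuous_enormP => p e e0.
  have [r r0 Hr] := cF (rsubmx p) e e0; exists r => // q qr; apply: Hr.
  by rewrite (le_lt_trans _ qr) // -[in leRHS](hsubmxK q) -[in leRHS](hsubmxK p)
    sub_row_mx enorm_row_mxr.
have cgh i : continuous (fun z => gh z 0 i).
  apply/continuous_enormP => p e e0; have [K K0 HK] := gh_lipschitz p 1.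
  have K1 : 0 < K + 1 by rewrite ltr_wpDl.
  exists (Num.min 1 (e / (K + 1))) => [|q]; first by rewrite lt_min ltr01 divr_gt0.
  rewrite lt_min ltr_pdivlMr // => /andP[q1 qe].
  have := coord_enorm (gh q - gh p) i; rewrite !mxE => /le_lt_trans; apply.
  rewrite (le_lt_trans (HK q p (ltW q1) _)) ?subrr ?enorm0 ?ler01 //.
  by rewrite (le_lt_trans _ qe) // mulrC ler_wpM2l ?lerDl ?enorm_ge0.
have cc i : continuous (fun z : 'rV[R]_d => z 0 i).
  apply/continuous_enormP => p e e0; exists e => // q qe.
  by have := coord_enorm (q - p) i; rewrite !mxE => /le_lt_trans; apply.
have [ch cf1] := (rconvex_continuous h_convex, rconvex_continuous f1_convex).
have [cf2 cg] := (rconvex_continuous f2_convex, rconvex_continuous g_convex).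
apply: realfun_continuousD.
  apply: (cl psi); apply: realfun_continuousD => //.
  exact: realfun_continuousB.
apply: realfun_continuousM; first exact: cst_continuous.
apply: realfun_continuousB; first by apply: realfun_continuousB; [exact: cr | exact: cl].
have E : (fun z : 'rV[R]_(d + d) => dotp (gh (lsubmx z)) (rsubmx z - lsubmx z)) =
    (fun z => \sum_i gh (lsubmx z) 0 i * (rsubmx z 0 i - lsubmx z 0 i)).
  by apply/funext => z; apply: eq_bigr => i _; rewrite !mxE.
rewrite E; apply: realfun_continuous_sum => i.
apply: (realfun_continuousM (cl _ (cgh i)) _).
by apply: realfun_continuousB; [exact: cr (cc i) | exact: cl (cc i)].
Qed.

Lemma dist0_subdiff_aux_funr x y v2 w K : has_grad f2 x v2 -> subgrad g x w -> 0 <= K ->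
  (forall z, enorm (z - x) <= 1 -> enorm (gh x - gh z) <= K * enorm (x - z)) ->
  (dist0 (subdiff (EFin \o aux_funr) (row_mx x y)) <=
    (enorm (gf1 x - v2 + w) + M * enorm (gh y - gh x) + M * K * enorm (y - x))%:E)%E.
Proof.
move=> gf2 sg K0 lipK; apply/lee_addgt0Pr => e e0.
have e2 : 0 < e / 2 by rewrite divr_gt0.
have [r r0 Hr] := aux_funr_lower y gf2 sg K0 lipK e2.
apply: (le_trans (approx_subgrad continuous_aux_funr _ e2 r0 Hr)).
  by rewrite addr_ge0 ?mulr_ge0 ?enorm_ge0 // ltW.
rewrite lee_fin.
have := enorm_row_mx_le (gf1 x - v2 + w) (M *: (gh y - gh x)).
rewrite enormZ ger0_norm //; lra.
Qed.

End AuxiliaryFunction.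

(** * Convergence of BPDCAe *)

Section SequenceLimits.
Context {R : realType} {n : nat}.
Implicit Types (p q xi : 'rV[R]_n) (u v : nat -> 'rV[R]_n).

Lemma cvg_enorm_close u v p : u @ \oo --> p ->
  (fun k => enorm (v k - u k)) @ \oo --> (0 : R) -> v @ \oo --> p.
Proof.
move=> /cvg_enormP up vu; apply/cvg_enormP => e e0.
have e2 : 0 < e / 2 by rewrite divr_gt0.
have [N1 HN1] := up _ e2.
have /cvgrPdist_lt/(_ _ e2)[N2 _ HN2] := vu.
exists (maxn N1 N2) => k; rewrite geq_max => /andP[/HN1 k1 /HN2 /=].
rewrite sub0r normrN ger0_norm ?enorm_ge0 // => k2.
have := enormDB (v k) (u k) p; lra.
Qed.

Lemma subgrad_closed F p xi u v : continuous F -> u @ \oo --> p -> v @ \oo --> xi ->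
  (forall k, subgrad F (u k) (v k)) -> subgrad F p xi.
Proof.
move=> cF up vxi H q; rewrite -subr_ge0.
have Fu : F \o u @ \oo --> F p by exact: continuous_cvg (cF p) up.
have qu : (fun k => q - u k) @ \oo --> q - p by apply: cvgB up; exact: cvg_cst.
have lim : (fun k => F q - (F (u k) + dotp (v k) (q - u k))) @ \oo -->
    F q - (F p + dotp xi (q - p)).
  apply: cvgB; first exact: cvg_cst.
  by apply: cvgD => //; exact: dotp_cvg.
by apply: (cvgr_to_ge lim); apply: nearW => k; rewrite subr_ge0; exact: H.
Qed.

Lemma cvg_succ (u : nat -> R) (l : R) : u @ \oo --> l -> (fun k => u k.+1) @ \oo --> l.
Proof.
move=> ul; have : (fun k => u (k + 1)%N) @ \oo --> l by rewrite cvg_shiftn.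
by under eq_fun do rewrite addn1.
Qed.

End SequenceLimits.

Section BPDCAeConvergence.
Context {R : realType} {d : nat}.
Variables (h f1 f2 g : 'rV[R]_d -> R) (gh gf1 gf2 : 'rV[R]_d -> 'rV[R]_d).
Variables (L sigma lambda rho M V : R) (N0 : set 'rV[R]_d).
Variables (x y xi : nat -> 'rV[R]_d) (beta : nat -> R).
Hypothesis h_convex : rconvex h.
Hypothesis h_grad : forall p, has_grad h p (gh p).
Hypothesis h_strong : rconvex (fun z => h z - sigma / 2 * enorm z ^+ 2).
Hypothesis f1_convex : rconvex f1.
Hypothesis f1_grad : forall p, has_grad f1 p (gf1 p).
Hypothesis Lh_f1_convex : rconvex (fun z => L * h z - f1 z).
Hypothesis f2_convex : rconvex f2.
Hypothesis g_convex : rconvex g.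
Hypothesis grad_lipschitz : forall B : set 'rV[R]_d, ebounded B ->
  elipschitz_on B gh /\ elipschitz_on B gf1.
Hypothesis sigma_gt0 : 0 < sigma.
Hypothesis lambda_gt0 : 0 < lambda.
Hypothesis lambdaL : lambda * L < 1.
Hypothesis M_gt0 : 0 < M.
Hypothesis M_bounds : rho / lambda <= M <= lambda^-1.
Hypothesis rho_lt1 : rho < 1.
Local Notation psi := (fun p => f1 p - f2 p + g p).
Local Notation D := (breg h gh).
Local Notation HM := (aux_funr h f1 f2 g gh M).
Hypothesis psi_ge : forall p, V <= psi p.
Hypothesis psi_level : forall r, exists K, forall p, psi p <= r -> enorm p <= K.
Hypothesis crit_in_N0 : forall p u w, subgrad f2 p u -> subgrad g p w ->
  0 = gf1 p - u + w -> N0 p.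
Hypothesis N0_open : open N0.
Hypothesis f2_grad : forall p, N0 p -> has_grad f2 p (gf2 p).
Hypothesis gf2_lipschitz : forall p, N0 p ->
  exists2 U, nbhs p U & elipschitz_on (U `&` N0) gf2.
Hypothesis HM_KL : KL_function (EFin \o HM).
Hypothesis beta01 : forall k, 0 <= beta k <= 1.
Hypothesis yE : forall k, y k = x k + beta k *: (x k - x k.-1).
Hypothesis y_restart : forall k, D (x k) (y k) <= rho * D (x k.-1) (x k).
Hypothesis xi_subgrad : forall k, subgrad f2 (x k) (xi k).
Hypothesis x_prox : forall k v,
  g (x k.+1) + dotp (gf1 (y k) - xi k) (x k.+1 - y k) + lambda^-1 * D (x k.+1) (y k) <=
  g v + dotp (gf1 (y k) - xi k) (v - y k) + lambda^-1 * D v (y k).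

Let a k := enorm (x k - x k.-1).
Let H k := HM (row_mx (x k) (x k.-1)).
Let w k := - (gf1 (y k) - xi k) - lambda^-1 *: (gh (x k.+1) - gh (y k)).

Let HE k : H k = psi (x k) + M * D (x k.-1) (x k).
Proof. by rewrite /H /aux_funr row_mxKl row_mxKr. Qed.

Let w_subgrad k : subgrad g (x k.+1) (w k).
Proof. exact: (prox_subgrad h_grad g_convex lambda_gt0 (x_prox k)). Qed.

(** The restart test replaces [D (x k) (y k)] by [rho * D (x k.-1) (x k)], and the term with factor
    [lambda^-1 - L] is dropped, being nonnegative since [lambda * L < 1]. *)
Let H_step k : (lambda^-1 - M) * D (x k) (x k.+1) + (M - rho / lambda) * D (x k.-1) (x k) <=
  H k - H k.+1.
Proof.
have := prox_step_descent h_grad f1_convex f1_grad Lh_f1_convex g_convex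
  lambda_gt0 (xi_subgrad k) (x_prox k).
rewrite !HE /=.
have li0 : 0 < lambda^-1 by rewrite invr_gt0.
have := ler_wpM2l (ltW li0) (y_restart k).
have : 0 <= (lambda^-1 - L) * D (x k.+1) (y k).
  rewrite mulr_ge0 ?breg_ge0 // subr_ge0 -(ler_pM2l lambda_gt0) mulfV ?gt_eqF //.
  exact: ltW.
lra.
Qed.

(** As [rho < 1], the two weights in [H_step] cannot both vanish. The boolean selects a positive
    one, and [breg_strong] turns its Bregman distance into a squared step. *)
Lemma H_descent : exists b : bool, exists2 c, 0 < c &
  forall k, c * a (k + b)%N ^+ 2 <= H k - H k.+1.
Proof.
have [Ml Mu] := andP M_bounds.
have s2 : 0 < sigma / 2 by rewrite divr_gt0.
have [Mlt|Mge] := ltP M lambda^-1.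
  exists true, ((lambda^-1 - M) * (sigma / 2)).
    by rewrite mulr_gt0 // subr_gt0.
  move=> k; apply: le_trans (H_step k); rewrite addn1 -mulrA /a /= enormB.
  rewrite (@le_trans _ _ ((lambda^-1 - M) * D (x k) (x k.+1))) //.
    by rewrite ler_wpM2l ?subr_ge0 // breg_strong.
  by rewrite lerDl mulr_ge0 ?breg_ge0 // subr_ge0.
have rM : 0 < M - rho / lambda.
  by rewrite subr_gt0 (lt_le_trans _ Mge) // mulrC gtr_pMr ?invr_gt0.
exists false, ((M - rho / lambda) * (sigma / 2)); first by rewrite mulr_gt0.
move=> k; apply: le_trans (H_step k); rewrite addn0 -mulrA /a enormB.
rewrite (@le_trans _ _ ((M - rho / lambda) * D (x k.-1) (x k))) //.
  by rewrite ler_wpM2l ?(ltW rM) // breg_strong.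
by rewrite lerDr mulr_ge0 ?breg_ge0 // subr_ge0.
Qed.

Let H_decr : nonincreasing_seq H.
Proof.
have [b [c c0 Hc]] := H_descent.
apply/nonincreasing_seqP => k; rewrite -subr_ge0; apply: le_trans (Hc k).
by rewrite mulr_ge0 ?sqr_ge0 // ltW.
Qed.

Let psi_le_H k : psi (x k) <= H k.
Proof. by rewrite HE lerDl mulr_ge0 ?breg_ge0 // ltW. Qed.

Lemma H_cvg : exists zeta : R, H @ \oo --> zeta.
Proof.
exists (inf (H @` setT)); apply: nonincreasing_cvgn => //.
by exists V => _ [k _ <-]; apply: le_trans (psi_le_H k).
Qed.

Lemma iterates_bounded : exists K, forall k, enorm (x k) <= K /\ enorm (y k) <= K.
Proof.
have [K HK] := psi_level (H 0); exists (3 * K) => k.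
have xK j : enorm (x j) <= K.
  by apply: HK; apply: le_trans (psi_le_H j) _; apply: H_decr.
have K0 : 0 <= K by apply: le_trans (xK 0%N); exact: enorm_ge0.
split; first by rewrite (le_trans (xK k)) //; lra.
rewrite yE (le_trans (enormD _ _)) // enormZ.
have /andP[b0 b1] := beta01 k; rewrite ger0_norm //.
have := enormD (x k) (- x k.-1); rewrite enormN => aa.
have := ler_wpM2r (enorm_ge0 (x k - x k.-1)) b1; have := xK k; have := xK k.-1; lra.
Qed.

Let dist_xy k : enorm (x k.+1 - y k) <= a k.+1 + a k.
Proof.
rewrite yE opprD addrA (le_trans (enormD _ _)) // /a /= lerD2l enormN enormZ.
have /andP[b0 b1] := beta01 k; rewrite ger0_norm //.
by rewrite -[leRHS]mul1r ler_wpM2r ?enorm_ge0.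
Qed.

Lemma local_lipschitz p r : exists2 K, 0 <= K & forall q z,
  enorm (q - p) <= r -> enorm (z - p) <= r ->
  enorm (gh q - gh z) <= K * enorm (q - z) /\ enorm (gf1 q - gf1 z) <= K * enorm (q - z).
Proof.
have B : ebounded [set q | enorm (q - p) <= r].
  exists (r + enorm p) => q /= qr; rewrite -(subrK p q) (le_trans (enormD _ _)) //.
  by rewrite lerD2r.
have [[K1 HK1] [K2 HK2]] := grad_lipschitz B.
exists (`|K1| + `|K2|) => [|q z qr zr]; first by rewrite addr_ge0.
split; [apply: le_trans (HK1 q z qr zr) _ | apply: le_trans (HK2 q z qr zr) _];
  rewrite ler_wpM2r ?enorm_ge0 // (le_trans (ler_norm _)) ?lerDl ?lerDr //.
Qed.


Let gh_lipschitz p r : exists2 K, 0 <= K & forall q z,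
  enorm (q - p) <= r -> enorm (z - p) <= r -> enorm (gh q - gh z) <= K * enorm (q - z).
Proof.
by have [K K0 HK] := local_lipschitz p r; exists K => // q z qr zr; have [] := HK q z qr zr.
Qed.

Let a_cvg0 : a @ \oo --> (0 : R).
Proof.
by have [b [c c0 Hc]] := H_descent; have [zeta Hz] := H_cvg; exact: descent_step_cvg0 Hc Hz.
Qed.

Let xy_cvg0 : (fun k => enorm (x k.+1 - y k)) @ \oo --> (0 : R).
Proof.
apply: (@squeeze_cvgr _ _ _ _ (fun=> 0) (fun k => a k.+1 + a k)).
- by apply: nearW => k; rewrite enorm_ge0 dist_xy.
- exact: cvg_cst.
- by rewrite -[X in _ --> X](addr0 0); apply: cvgD => //; exact: cvg_succ.
Qed.

Let gh_gf1_cvg (u v : nat -> 'rV[R]_d) p : u @ \oo --> p -> v @ \oo --> p ->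
  (fun k => gh (u k) - gh (v k)) @ \oo --> (0 : 'rV[R]_d) /\ (gf1 \o u) @ \oo --> gf1 p.
Proof.
move=> up vp; have [K K0 HK] := local_lipschitz p 1.
have K1 : 0 < K + 1 by rewrite ltr_wpDl.
split; apply/cvg_enormP => e e0.
  have e1 : 0 < Num.min 1 (e / 2 / (K + 1)) by rewrite lt_min ltr01 !divr_gt0.
  have [n1 Hn1] := proj1 (cvg_enormP _ _) up _ e1.
  have [n2 Hn2] := proj1 (cvg_enormP _ _) vp _ e1.
  exists (maxn n1 n2) => k; rewrite geq_max => /andP[/Hn1 + /Hn2].
  rewrite !lt_min !ltr_pdivlMr // => /andP[u1 ue] /andP[v1 ve].
  have [lk _] := HK (u k) (v k) (ltW u1) (ltW v1); rewrite subr0 (le_lt_trans lk) //.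
  have := ler_wpM2l K0 (enormDB (u k) p (v k)); rewrite (enormB p).
  have := enorm_ge0 (u k - p); have := enorm_ge0 (v k - p); nra.
have e1 : 0 < Num.min 1 (e / (K + 1)) by rewrite lt_min ltr01 !divr_gt0.
have [n1 Hn1] := proj1 (cvg_enormP _ _) up _ e1.
exists n1 => k /Hn1; rewrite lt_min ltr_pdivlMr // => /andP[u1 ue].
have [|_ lk] := HK (u k) p (ltW u1); first by rewrite subrr enorm0.
by rewrite (le_lt_trans lk) // (le_lt_trans _ ue) // mulrC ler_wpM2l ?lerDl ?enorm_ge0.
Qed.

(** The subgradients of [f2] and [g] live at [x k] and [x k.+1], and [gf1] is taken at [y k].
    Vanishing steps let all three sequences converge to [p] along the same indices, and the term in
    [gh] disappears in the limit. *)
Lemma cluster_critical p : cluster (x @ \oo) p ->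
  exists u z, [/\ subgrad f2 p u, subgrad g p z & 0 = gf1 p - u + z].
Proof.
move=> /cluster_subseq[e ek xe].
(* The indices are the predecessors of those of the subsequence; starting from [e k.+1 >= 1] ensures
   that they exist. *)
pose e1 k := (e k.+1).-1.
have e1S k : (e1 k).+1 = e k.+1 by rewrite /e1 prednK // (leq_trans _ (ek k.+1)).
have e1k k : (k <= e1 k)%N by rewrite -ltnS e1S.
have e1oo := subseq_infty e1k.
have xSe : (fun k => x (e1 k).+1) @ \oo --> p.
  apply/cvg_enormP => r r0; have [m Hm] := proj1 (cvg_enormP _ _) xe r r0.
  by exists m => k mk; rewrite e1S; apply: Hm; rewrite ltnW.
have xe1 : (x \o e1) @ \oo --> p.
  apply: (cvg_enorm_close xSe); under eq_fun do rewrite enormB.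
  exact: (cvg_comp _ _ e1oo (cvg_succ a_cvg0)).
have ye1 : (y \o e1) @ \oo --> p.
  apply: (cvg_enorm_close xSe); under eq_fun do rewrite enormB.
  exact: (cvg_comp _ _ e1oo xy_cvg0).
have [K HK] := subgrad_bounded p f2_convex.
(* The bound on subgradients of [f2] holds in the unit ball around [p], so the first [m] indices are
   skipped. *)
have [m Hm] := proj1 (cvg_enormP _ _) xe1 1 ltr01.
have xiK k : enorm (xi (e1 (k + m)%N)) <= K.
  by apply: HK (xi_subgrad _); apply/ltW/Hm; exact: leq_addl.
have [u /cluster_subseq[j jk xiu]] := enorm_bounded_cluster xiK.
pose s k := (j k + m)%N.
have soo : s @ \oo --> \oo by apply: subseq_infty => k; rewrite (leq_trans (jk k)) ?leq_addr.
have xs := cvg_comp _ _ soo xe1.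
have xSs := cvg_comp _ _ soo xSe.
have ys := cvg_comp _ _ soo ye1.
exists u, (- (gf1 p - u) - lambda^-1 *: (0 : 'rV[R]_d)); split.
- by apply: (subgrad_closed (rconvex_continuous f2_convex) xs xiu) => k /=; exact: xi_subgrad.
- apply: (subgrad_closed (rconvex_continuous g_convex) xSs) => [|k /=]; last exact: w_subgrad.
  have [gh0 _] := gh_gf1_cvg xSs ys; have [_ gf1p] := gh_gf1_cvg ys ys.
  exact: (cvgB (cvgN (cvgB gf1p xiu)) (cvgZ (cvg_cst _) gh0)).
- by rewrite scaler0 subr0 subrr.
Qed.


Lemma cluster_N0 p : cluster (x @ \oo) p -> N0 p.
Proof. by move=> /cluster_critical[u [z [f2u gz]]]; exact: crit_in_N0 f2u gz. Qed.

Lemma cluster_subgrad p : cluster (x @ \oo) p ->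
  exists2 z, subgrad g p z & gf1 p - gf2 p + z = 0.
Proof.
move=> px; have [u [z [f2u gz E]]] := cluster_critical px; exists z => //.
by rewrite -(has_grad_unique (f2_grad (cluster_N0 px)) f2u).
Qed.

(** Near [p] the chosen [xi k] must be [gf2 (x k)], and [w k] is the matching subgradient of [g];
    inserting both turns the subgradient of [psi] at [x k.+1] into differences of gradients at
    nearby points. *)
Lemma residual_bound p : N0 p -> exists C0 r, [/\ 0 <= C0, 0 < r &
  forall k, enorm (x k.+1 - p) < r -> enorm (x k - p) < r ->
  (dist0 (subdiff (EFin \o HM) (row_mx (x k.+1) (x k))) <=
     (C0 * (a k.+1 + a k))%:E)%E].
Proof.
move=> Np; have [Kb HKb] := iterates_bounded.
(* The extra 1 covers the points within distance 1 of an iterate, for which [lx] needs the Lipschitz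
   bound. *)
have [K K0 HK] := local_lipschitz 0 (Kb + 1).
have lip q z : enorm q <= Kb + 1 -> enorm z <= Kb + 1 ->
    enorm (gh q - gh z) <= K * enorm (q - z) /\ enorm (gf1 q - gf1 z) <= K * enorm (q - z).
  by move=> qK zK; apply: HK; rewrite subr0.
have [xB yB] : (forall k, enorm (x k) <= Kb + 1) /\ (forall k, enorm (y k) <= Kb + 1).
  by split=> k; have [xk yk] := HKb k; rewrite ler_wpDr.
have [U /nbhs_enormP[r1 r10 HU] [K2 HK2]] := gf2_lipschitz Np.
have [r2 r20 HN0] : exists2 r, 0 < r & forall q, enorm (q - p) < r -> N0 q.
  by apply/nbhs_enormP; exact: open_nbhs_nbhs.
have li0 : 0 < lambda^-1 by rewrite invr_gt0.
(* In order, the terms bound the differences of [gf1], of [gf2], of [gh] in [w k], of [gh] in the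
   second component, and the slope of the cone. *)
exists (K + `|K2| + lambda^-1 * K + M * K + M * K), (Num.min r1 r2); split.
- by rewrite !addr_ge0 // mulr_ge0 // ltW.
- by rewrite lt_min r10.
move=> k; rewrite !lt_min => /andP[x1U x1N] /andP[xU xN].
have xiE : xi k = gf2 (x k) by exact: has_grad_unique (f2_grad (HN0 _ xN)) (xi_subgrad k).
have lx z : enorm (z - x k.+1) <= 1 -> enorm (gh (x k.+1) - gh z) <= K * enorm (x k.+1 - z).
  move=> zx; suff zB : enorm z <= Kb + 1 by have [] := lip _ _ (xB k.+1) zB.
  have [xk1 _] := HKb k.+1.
  by rewrite -(subrK (x k.+1) z) (le_trans (enormD _ _)) // addrC lerD.
apply: (le_trans (dist0_subdiff_aux_funr h_convex h_grad f1_convex f1_grad f2_convex g_convex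
  (ltW M_gt0) gh_lipschitz (x k) (f2_grad (HN0 _ x1N)) (w_subgrad k) K0 lx)).
have [lh1 lf1] := lip _ _ (xB k.+1) (yB k).
have [lh2 _] := lip _ _ (xB k) (xB k.+1).
have l2 := HK2 (x k) (x k.+1) (conj (HU _ xU) (HN0 _ xN)) (conj (HU _ x1U) (HN0 _ x1N)).
have dxy := dist_xy k.
have aE : enorm (x k - x k.+1) = a k.+1 by rewrite enormB.
rewrite aE in lh2 l2 *.
have {}l2 : enorm (gf2 (x k) - gf2 (x k.+1)) <= `|K2| * a k.+1.
  by rewrite (le_trans l2) // ler_wpM2r ?enorm_ge0 // ler_norm.
have vE : gf1 (x k.+1) - gf2 (x k.+1) + w k = (gf1 (x k.+1) - gf1 (y k)) +
    (gf2 (x k) - gf2 (x k.+1)) + - (lambda^-1 *: (gh (x k.+1) - gh (y k))).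
  by rewrite /w xiE; apply/rowP => i; rewrite !mxE; ring.
rewrite lee_fin vE.
have := enormD (gf1 (x k.+1) - gf1 (y k) + (gf2 (x k) - gf2 (x k.+1)))
  (- (lambda^-1 *: (gh (x k.+1) - gh (y k)))).
have := enormD (gf1 (x k.+1) - gf1 (y k)) (gf2 (x k) - gf2 (x k.+1)).
rewrite enormN enormZ gtr0_norm //.
have := ler_wpM2l (ltW li0) lh1; have := ler_wpM2l (ltW M_gt0) lh2.
have := ler_wpM2l (ltW li0) (ler_wpM2l K0 dxy); have := ler_wpM2l K0 dxy.
have a0 j : 0 <= a j by exact: enorm_ge0.
have : 0 <= M * K * a k by rewrite !mulr_ge0 // ltW.
have : 0 <= `|K2| * a k by rewrite mulr_ge0.
lra.
Qed.

(** Since [H] already converges, it suffices to find late pairs of iterates near [(p, p)], where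
    [HM] is continuous with value [psi p]. *)
Lemma H_cvg_cluster p : cluster (x @ \oo) p -> H @ \oo --> psi p.
Proof.
move=> /cluster_enormP px; have [zeta Hz] := H_cvg.
suff -> : psi p = zeta by [].
have psiE : psi p = HM (row_mx p p) by rewrite /aux_funr row_mxKl row_mxKr bregpp mulr0 addr0.
apply/eqP; rewrite -subr_eq0 -normr_eq0; apply/eqP/le_anti; rewrite normr_ge0 andbT.
apply/ler_addgt0Pr => e e0; rewrite add0r.
have e2 : 0 < e / 2 by rewrite divr_gt0.
have /continuous_enormP/(_ (row_mx p p) _ e2)[r r0 Hr] :=
  continuous_aux_funr h_convex f1_convex f2_convex g_convex gh_lipschitz (M := M).
have r3 : 0 < r / 3 by rewrite divr_gt0.
have /cvgrPdist_lt/(_ _ e2)[n1 _ Hn1] := Hz.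
have /cvgrPdist_lt/(_ _ r3)[n2 _ Hn2] := a_cvg0.
have [k] := px _ (maxn n1 n2) r3; rewrite geq_max => /andP[/Hn1 /= Hk /Hn2 /=].
rewrite sub0r normrN ger0_norm ?enorm_ge0 // => ak xk.
have := Hr (row_mx (x k) (x k.-1)); rewrite -psiE sub_row_mx => /(_ _)/wrap[].
  rewrite (le_lt_trans (enorm_row_mx_le _ _)) //.
  have := enormDB (x k.-1) (x k) p; rewrite (enormB (x k.-1) (x k)) -/(a k); lra.
rewrite -/(H k) => Hk2; have := ler_distD (H k) (psi p) zeta.
rewrite (distrC (psi p) (H k)) (distrC (H k) zeta); lra.
Qed.

(** A KL function gives the inequality only where its subdifferential is nonempty. On the diagonal
    the cone in [aux_funr_lower] has slope [e] alone, and criticality makes the affine part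
    constant, so 0 is a regular subgradient. *)
Lemma KL_at_cluster p : cluster (x @ \oo) p -> KL_at (EFin \o HM) (row_mx p p).
Proof.
move=> px; apply: HM_KL; exists (row_mx 0 0).
have cHM := continuous_aux_funr h_convex f1_convex f2_convex g_convex gh_lipschitz (M := M).
apply: (reg_subgrad_subdiff cHM) => e e0.
have [z gz z0] := cluster_subgrad px.
have [K K0 HK] := gh_lipschitz p 1.
have lp q : enorm (q - p) <= 1 -> enorm (gh p - gh q) <= K * enorm (p - q).
  by move=> qp; apply: HK => //; rewrite subrr enorm0.
have [r r0 Hr] := aux_funr_lower h_convex h_grad f1_convex f1_grad (ltW M_gt0) p
  (f2_grad (cluster_N0 px)) gz K0 lp e0.
exists r => // q /Hr.
by rewrite z0 !subrr scaler0 enorm0 mulr0 add0r.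
Qed.

Theorem BPDCAe_convergence : exists p, [/\ x @ \oo --> p,
  (fun k => dist0 (subdiff (EFin \o HM) (row_mx (x k) (x k.-1)))) @ \oo --> 0%E,
  subdiff (EFin \o psi) p 0 &
  exists B, forall m, \sum_(1 <= k < m) a k <= B].
Proof.
have [Kb HKb] := iterates_bounded.
have [p px] := enorm_bounded_cluster (fun k => proj1 (HKb k)).
have [C0 [r [C00 r0 Hres]]] := residual_bound (cluster_N0 px).
have [eta [U [phi [eta0 /nbhs_enormP[r1 r10 HU] phi_des HKL]]]] := KL_at_cluster px.
have [b [c c0 Hdesc]] := H_descent.
have HMp : HM (row_mx p p) = psi p by rewrite /aux_funr row_mxKl row_mxKr bregpp mulr0 addr0.
(* The neighborhood [U] concerns pairs, whose norm is at most the sum of the norms of the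
   components; hence the half. *)
have rr0 : 0 < Num.min r (r1 / 2) by rewrite lt_min r0 divr_gt0.
have KLin k : (1 <= k)%N -> enorm (x k - p) < Num.min r (r1 / 2) ->
    enorm (x k.-1 - p) < Num.min r (r1 / 2) ->
    psi p < H k -> ((H k - psi p)%:E < eta)%E ->
    1 <= derive1 phi (H k - psi p) * (C0 * (a k + a k.-1)).
  case: k => // k _; rewrite /= !lt_min => /andP[x1r x1r1] /andP[xr xr1] Hk Heta.
  have Uk : U (row_mx (x k.+1) (x k)).
    apply: HU; rewrite sub_row_mx (le_lt_trans (enorm_row_mx_le _ _)) //; lra.
  have := HKL _ Uk; rewrite /= HMp lte_fin => /(_ Hk).
  have Heta' : ((H k.+1)%:E < (psi p)%:E + eta)%E by rewrite addeC -lteBlDr.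
  move=> /(_ Heta') /= kl.
  have [_ phi'0 _] : [/\ derivable phi (H k.+1 - psi p) 1, 0 < derive1 phi (H k.+1 - psi p) &
      {for (H k.+1 - psi p), continuous (derive1 phi)}].
    by case: phi_des => _ _ _ _; apply; split => //; rewrite subr_gt0.
  rewrite -lee_fin EFinM (le_trans kl) //.
  by apply: lee_wpmul2l; [rewrite lee_fin ltW | exact: Hres].
have [xp sumB] := finite_length c0 C00 Hdesc (H_cvg_cluster px) rr0 eta0 phi_des KLin px.
exists p; split=> //; last first.
  have [z gz z0] := cluster_subgrad px.
  apply: reg_subgrad_subdiff; last first.
    by rewrite -z0; exact: (psi_reg_subgrad f1_convex f1_grad (f2_grad (cluster_N0 px)) gz).
  apply: realfun_continuousD; last exact: rconvex_continuous.
  by apply: realfun_continuousB; exact: rconvex_continuous.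
have [n Hn] := proj1 (cvg_enormP _ _) xp r r0.
apply: (@squeeze_cvge _ _ _ _ (cst 0%E) _ (fun k => (C0 * (a k + a k.-1))%:E)).
- exists n.+1 => // -[//|k] /= nk; apply/andP; split.
    by apply: le_ereal_inf_tmp => _ [v _ <-]; rewrite lee_fin enorm_ge0.
  by apply: Hres; apply: Hn => //; exact: ltnW.
- exact: cvg_cst.
- apply: cvg_EFin; first exact: nearW.
  have a1 : (fun k => a k.-1) @ \oo --> (0 : R).
    have : (fun k => a (k + 1).-1) @ \oo --> (0 : R).
      by under eq_fun do rewrite addn1.
    by rewrite (cvg_shiftn 1 (fun k => a k.-1)).
  rewrite -[X in _ --> X](mulr0 C0) -[X in _ * X](addr0 0).
  by apply: cvgM; [exact: cvg_cst | exact: cvgD].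
Qed.

End BPDCAeConvergence.

(** * Extended-valued statement *)

Section RealValued.
Context {R : realType} {n : nat}.
Implicit Types (F : 'rV[R]_n -> R) (p q xi : 'rV[R]_n).

Lemma econvex_fin F : econvex_on setT (EFin \o F) -> rconvex F.
Proof.
move=> cF p q t t01; have := cF p q t I I t01.
by rewrite /= -!EFinM -EFinD lee_fin.
Qed.

Lemma csubdiff_finE F p : csubdiff (EFin \o F) p = subgrad F p.
Proof.
apply/seteqP; split=> xi H q; have := H q; rewrite /= -!EFinB lee_fin; lra.
Qed.

Lemma grad_fin F p : differentiable F p -> has_grad F p (grad (EFin \o F) p).
Proof. exact: differentiable_has_grad. Qed.

Lemma bregman_fin F p q :
  bregman (EFin \o F) p q = (breg F (grad (EFin \o F)) p q)%:E.
Proof. by rewrite /bregman /= -!EFinB. Qed.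

Lemma fin_numEFin (f : 'rV[R]_n -> \bar R) : (forall p, f p \is a fin_num) ->
  f = EFin \o (fine \o f).
Proof. by move=> ff; apply/funext => p /=; rewrite fineK. Qed.

End RealValued.

Lemma theta_next_ge (R : realType) (t : R) : 1 <= t -> t <= theta_next t.
Proof.
move=> t1; rewrite /theta_next ler_pdivlMr //.
have : 2 * t <= Num.sqrt (1 + 4 * t ^+ 2).
  have t0 : 0 <= 2 * t by lra.
  rewrite -[leLHS](ger0_norm t0) -sqrtr_sqr; apply: ler_wsqrtr; rewrite exprMn; lra.
lra.
Qed.

(** This invariant puts [(tp k - 1) / t k] in [[0, 1]], and it survives a restart because the new
    pair is [1] and [theta_next 1]. *)
Lemma thetas_bounds (R : realType) (tp t : nat -> R) (restart : nat -> Prop) :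
  tp 0 = 1 -> t 0 = 1 ->
  (forall k, restart k -> tp k.+1 = 1 /\ t k.+1 = theta_next 1) ->
  (forall k, ~ restart k -> tp k.+1 = t k /\ t k.+1 = theta_next (t k)) ->
  forall k, 1 <= tp k <= t k.
Proof.
move=> tp0 t0 rs nrs; elim=> [|k /andP[tp1 tpt]]; first by rewrite tp0 t0 !lexx.
have [/rs[-> ->]|/nrs[-> ->]] := pselect (restart k).
  by rewrite lexx theta_next_ge.
by rewrite theta_next_ge (le_trans tp1).
Qed.

Unset Implicit Arguments.

Theorem theorem7 (R : realType) (d : nat) (C N0 : set 'rV[R]_d)
    (h f1 f2 g : 'rV[R]_d -> \bar R) (L sigma rho lambda M : R)
    (x : nat -> 'rV[R]_d)
    (C_nonempty : C !=set0)
    (C_convex : @convex_set R 'rV[R]_d C)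
    (C_open : open C)
    (rho_bounds : 0 <= rho < 1)
    (basic : basic_assumptions C h f1 f2 g)
    (L_gt0 : 0 < L)
    (smad : Lsmad L C f1 h)
    (argmin_in_C : forall (u v xi : 'rV[R]_d) (lambda' : R),
       C u -> C v -> csubdiff f2 u xi -> 0 < lambda' ->
       bregman_argmin C h f1 g lambda' xi v `<=` C)
    (* (a) *)
    (dom_h : edom h = setT)
    (sigma_gt0 : 0 < sigma)
    (h_strongly_convex : strongly_convex sigma h)
    (* (b) *)
    (grad_lipschitz : forall B : set 'rV[R]_d, ebounded B ->
       elipschitz_on B (grad h) /\ elipschitz_on B (grad f1))
    (* (c) *)
    (Psi_level_bounded : level_bounded (DCobj f1 f2 g))
    (* (d) *)
    (N0_open : open N0)
    (crit_in_N0 : limiting_critical f1 f2 g `<=` N0)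
    (f2_C1 : C1_on N0 f2)
    (grad_f2_loc_lipschitz : forall z, N0 z ->
       exists2 V, nbhs z V & elipschitz_on (V `&` N0) (grad f2))
    (* (e) *)
    (g_convex : econvex_on setT g)
    (* (f) *)
    (clarke_bounded : forall B : set 'rV[R]_d, ebounded B ->
       exists u : 'rV[R]_d -> 'M[R]_d,
         (forall z, B z -> clarke_jacobian (grad h) z (u z)) /\
         exists K : R, forall z, B z -> `|u z| <= K)
    (* (g) *)
    (M_gt0 : 0 < M)
    (M_bounds : rho / lambda <= M <= lambda^-1)
    (HM_KL : KL_function (aux_fun h f1 f2 g M))
    (lambda_gt0 : 0 < lambda)
    (lambdaL : 0 < lambda * L < 1)
    (x_BPDCAe : BPDCAe C h f1 f2 g lambda rho x) :
  let Psi := DCobj f1 f2 g in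
  let HM := aux_fun h f1 f2 g M in
  let Omega := cluster (x @ \oo) in
  let Upsilon := [set row_mx p p | p in Omega] in
  exists zeta : R,
    [/\ (Psi \o x) @ \oo --> zeta%:E,
        (* (i) *)
        (fun k => dist0 (subdiff HM (row_mx (x k) (x k.-1)))) @ \oo --> 0%E,
        (* (ii) *)
        cluster ((fun k => row_mx (x k) (x k.-1)) @ \oo) = Upsilon /\
        (forall z, Upsilon z -> HM z = zeta%:E) &
        (* (iii) *)
        (exists2 xbar, limiting_stationary f1 f2 g xbar & x @ \oo --> xbar) /\
        (\sum_(1 <= k <oo) (enorm (x k - x k.-1))%:E < +oo)%E].
Proof.
move=> Psi HM Omega Upsilon.
have [[hG _] _ _ _ inf_gt _] := basic.
have [[f1_proper f1_cvx dom_f1g f1_C1] [f2_proper f2_cvx] [g_proper _ _]] :=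
  And3 (ba_f1 basic) (ba_f2 basic) (ba_g basic).
have [[h_proper _ h_cvx] _ _ hC h_C1] := hG.
have CT : C = setT by rewrite -hC dom_h interiorT.
rewrite CT in h_C1 f1_C1.
have [h_fin h_diff _] := h_C1; have [f1_fin f1_diff _] := f1_C1.
(* Every point is in [edom h], hence in the domain of [f1 + g]; since [f1] is finite, [g] cannot be
   [+oo]. *)
have g_fin p : g p \is a fin_num.
  have : edom h p by rewrite dom_h.
  move=> /dom_f1g; rewrite /edom /= -(fineK (f1_fin p I)) => fg.
  rewrite fin_numElt (proj1 g_proper) /=.
  by move: fg; case: (g p) => [r _||] //=; rewrite ltry.
(* A value [+oo] of [f2] would make the objective [-oo], against its lower bound. *)
have f2_fin p : f2 p \is a fin_num.
  rewrite fin_numElt (proj1 f2_proper) /= ltNge leye_eq; apply/negP => /eqP f2y.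
  have : (ereal_inf [set DCobj f1 f2 g x | x in closure C] <= DCobj f1 f2 g p)%E.
    by apply: ereal_inf_lbound; exists p => //; rewrite CT closureT.
  rewrite {2}/DCobj f2y -(fineK (f1_fin p I)) -(fineK (g_fin p)) /= leeNy_eq => /eqP E.
  by rewrite E ltxx in inf_gt.
have [hr hE] : exists hr, h = EFin \o hr.
  by exists (fine \o h); apply: fin_numEFin => p; exact: h_fin.
have [f1r f1E] : exists f1r, f1 = EFin \o f1r.
  by exists (fine \o f1); apply: fin_numEFin => p; exact: f1_fin.
have [f2r f2E] : exists f2r, f2 = EFin \o f2r.
  by exists (fine \o f2); exact: fin_numEFin.
have [gr gE] : exists gr, g = EFin \o gr.
  by exists (fine \o g); exact: fin_numEFin.
subst h f1 f2 g.
set gh := grad (EFin \o hr) in grad_lipschitz *; set gf1 := grad (EFin \o f1r) in grad_lipschitz *.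
set gf2 := grad (EFin \o f2r) in grad_f2_loc_lipschitz *.
pose psi p := f1r p - f2r p + gr p.
have PsiE : Psi = EFin \o psi by [].
have HME : HM = EFin \o aux_funr hr f1r f2r gr gh M.
  by apply/funext => z; rewrite /HM /aux_fun bregman_fin.
have hr_cvx := econvex_fin h_cvx.
have f1r_cvx := econvex_fin f1_cvx.
have f2r_cvx := econvex_fin f2_cvx.
have gr_cvx := econvex_fin g_convex.
have hr_grad p : has_grad hr p (gh p) by apply: grad_fin; exact: h_diff.
have f1r_grad p : has_grad f1r p (gf1 p) by apply: grad_fin; exact: f1_diff.
have f2r_grad p : N0 p -> has_grad f2r p (gf2 p).
  by case: f2_C1 => _ f2_diff _ Np; apply: grad_fin; exact: f2_diff.
have h_strong : rconvex (fun z => hr z - sigma / 2 * enorm z ^+ 2).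
  exact: econvex_fin h_strongly_convex.
have Lh_cvx : rconvex (fun z => L * hr z - f1r z).
  by apply: econvex_fin; case: smad => _ _ _; rewrite CT.
have [V psi_ge] : exists V, forall p, V <= psi p.
  have lb p : (ereal_inf [set Psi x | x in closure C] <= (psi p)%:E)%E.
    by apply: ereal_inf_lbound; exists p => //; rewrite CT closureT.
  move: inf_gt lb; rewrite -/Psi; case: ereal_inf => [V _ lb||]; last by [].
    by exists V => p; have := lb p; rewrite lee_fin.
  by move=> _ /(_ 0); rewrite leye_eq.
have level r : exists K, forall p, psi p <= r -> enorm p <= K.
  by have [K HK] := Psi_level_bounded r; exists K => p pr; apply: HK; rewrite /= lee_fin.
have crit p u w : subgrad f2r p u -> subgrad gr p w -> 0 = gf1 p - u + w -> N0 p.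
  move=> f2u gw E; apply: crit_in_N0; exists u, w; split=> //; first by rewrite csubdiff_finE.
  by apply: reg_subgrad_subdiff (subgrad_reg gw); exact: rconvex_continuous.
have [_ [xi [y [tp [t [beta [tp0 t0 steps]]]]]]] := x_BPDCAe.
pose restart k := ~ C (x k + (tp k - 1) / t k *: (x k - x k.-1)) \/
  (rho%:E * bregman (EFin \o hr) (x k.-1) (x k) <
   bregman (EFin \o hr) (x k) (x k + (tp k - 1) / t k *: (x k - x k.-1)))%E.
have tb : forall k, 1 <= tp k <= t k.
  apply: (@thetas_bounds _ tp t restart) => // k rk; have [_ rs nrs _ _] := steps k.
    by have [] := rs rk.
  by have [] := nrs rk.
have beta01 k : 0 <= beta k <= 1.
  have [_ rs nrs _ _] := steps k; have /andP[tp1 tpt] := tb k.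
  have tk : 0 < t k by lra.
  have [/rs[-> _ _]|/nrs[-> _ _]] := pselect (restart k); first by rewrite lexx ler01.
  by rewrite divr_ge0 ?subr_ge0 ?(ltW tk) //= ler_pdivrMr // mul1r; lra.
have yE k : y k = x k + beta k *: (x k - x k.-1) by have [] := steps k.
have y_restart k : breg hr gh (x k) (y k) <= rho * breg hr gh (x k.-1) (x k).
  have [_ rs nrs ykE _] := steps k.
  (* After a restart [y k = x k], so the left side is 0 and [0 <= rho] suffices; otherwise the
     inequality is the negated second clause of the test. *)
  have [/rs[b0 _ _]|nr] := pselect (restart k).
    rewrite ykE b0 scale0r addr0 bregpp mulr_ge0 ?breg_ge0 //.
    by case/andP: rho_bounds.
  have [bE _ _] := nrs nr; rewrite ykE bE.
  rewrite leNgt; apply/negP => lt; apply: nr; right.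
  by rewrite !bregman_fin -EFinM lte_fin.
have xi_sub k : subgrad f2r (x k) (xi k).
  by have [+ _ _ _ _] := steps k; rewrite csubdiff_finE.
have prox k v :
    gr (x k.+1) + dotp (gf1 (y k) - xi k) (x k.+1 - y k) + lambda^-1 * breg hr gh (x k.+1) (y k) <=
    gr v + dotp (gf1 (y k) - xi k) (v - y k) + lambda^-1 * breg hr gh v (y k).
  have [_ _ _ _ [_ /(_ v)]] := steps k; rewrite CT closureT => /(_ I).
  by rewrite /model !bregman_fin /= -!EFinM -!EFinD lee_fin.
have rho1 : rho < 1 by case/andP: rho_bounds.
have lL : lambda * L < 1 by case/andP: lambdaL.
rewrite HME in HM_KL *.
have [p [xp dist0_cvg stat [B sumB]]] := BPDCAe_convergence hr_cvx hr_grad h_strong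
  f1r_cvx f1r_grad Lh_cvx f2r_cvx gr_cvx grad_lipschitz sigma_gt0 lambda_gt0 lL M_gt0
  M_bounds rho1 psi_ge level crit N0_open f2r_grad grad_f2_loc_lipschitz HM_KL beta01 yE
  y_restart xi_sub prox.
have psi_cont : continuous psi.
  apply: realfun_continuousD; last exact: rconvex_continuous.
  by apply: realfun_continuousB; exact: rconvex_continuous.
have OmegaE : Omega = [set p] := cvg_cluster_set1 xp.
have UpsilonE : Upsilon = [set row_mx p p] by rewrite /Upsilon OmegaE image_set1.
have pair_cvg : (fun k => row_mx (x k) (x k.-1)) @ \oo --> row_mx p p.
  apply/cvg_enormP => e e0.
  have [N HN] := proj1 (cvg_enormP _ _) xp _ (divr_gt0 e0 (ltr0Sn R 1)).
  (* From [N.+1] on, the predecessor index is also at least [N]. *)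
  exists N.+1 => -[//|k] kN; rewrite sub_row_mx (le_lt_trans (enorm_row_mx_le _ _)) //.
  have := HN k kN; have := HN k.+1 (ltnW kN); rewrite /=; lra.
exists (psi p); split.
- rewrite PsiE; apply: cvg_EFin; first exact: nearW.
  exact: continuous_cvg (psi_cont p) xp.
- exact: dist0_cvg.
- split; first by rewrite UpsilonE; exact: cvg_cluster_set1.
  by rewrite UpsilonE => _ ->; rewrite /= /aux_funr row_mxKl row_mxKr bregpp mulr0 addr0.
- split; first by exists p.
  apply: (@le_lt_trans _ _ B%:E); last exact: ltry.
  apply: lime_le; first by apply: is_cvg_nneseries => k _ _; rewrite lee_fin enorm_ge0.
  by apply: nearW => m; rewrite sumEFin lee_fin.
Qed.
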